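(* Let $X = (X_n)_{n \geq 0}$ be a discrete-time homogeneous irreducible Markov chain on a finite state space $\mathcal{X}$ with transition matrix $P = (P_{i,j})_{i,j \in \mathcal{X}}$ and stationary distribution $\pi = (\pi_i)_{i \in \mathcal{X}}$. Say that $X$ has constant row entropy if $H(P_{i,\cdot}) = H(P_{j,\cdot})$ for all $i,j\in\mathcal{X}$. Then the following hold. (1) (Commute entropy velocity formula; constant row entropy is not required.) For any $i \neq j \in \mathcal{X}$, $$H^c_{i,j} = t^c_{i,j}\, H(X).$$ (2) (Average entropy velocity formula.) If $X$ has constant row entropy, then $$H^{av} = (t^{av} + 1) H(X).$$ If in addition $X$ is reversible (and $|\mathcal{X}| \geq 2$, so that $t^{rel}$ is defined), then $$(t^{rel} + 1) H(X) \leq H^{av} \leq \big((|\mathcal{X}|-1)\, t^{rel} + 1\big) \log |\mathcal{X}|.$$ (3) (Entropic random target lemma.) If $X$ has constant row entropy, then the quantity $$\sum_{j \in \mathcal{X}} \pi_j H_{i,j}$$ does not depend on $i \in \mathcal{X}$. (4) (Entropic cyclic tour lemma.) If $X$ has constant row entropy and is reversible, then for any $i, j, k \in \mathcal{X}$ with $i \neq j \neq k$ (that is, $i \neq j$ and $j \neq k$), $$H_{i,j} + H_{j,k} + H_{k,i} = H_{i,k} + H_{k,j} + H_{j,i}.$$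
   Context: The convention $0\log 0 = 0$ is used throughout. One-step local entropy at state $i$: $H(P_{i,\cdot}) := -\sum_{j \in \mathcal{X}} P_{i,j}\log P_{i,j}$. Entropy rate of the chain: $H(X) := -\sum_{i,j\in\mathcal{X}} \pi_i P_{i,j}\log P_{i,j} = \sum_{i \in \mathcal{X}} \pi_i H(P_{i,\cdot})$. Entropy of Markov trajectories: for $i,j \in \mathcal{X}$ (possibly $i=j$), a trajectory $T_{i,j} = i x_1 x_2 \ldots x_{k-1} j$ from $i$ to $j$ is a finite path of $k \geq 1$ steps with initial state $i$, final state $j$, and no intervening state $x_1,\dots,x_{k-1}$ equal to $j$. Its probability is $p(T_{i,j}) := P_{i,x_1}P_{x_1,x_2}\cdots P_{x_{k-1},j}$ (which is $P_{i,j}$ when $k=1$). With $\mathcal{T}_{i,j}$ the set of all trajectories from $i$ to $j$, $$H_{i,j} := -\sum_{T_{i,j} \in \mathcal{T}_{i,j}} p(T_{i,j}) \log p(T_{i,j}).$$ Hitting time: $\tau_j := \inf\{n \geq 0 : X_n = j\}$, with $\inf\emptyset = \infty$ (so $\mathbb{E}_j(\tau_j)=0$); $\mathbb{E}_i$ denotes expectation for the chain started at $X_0 = i$. Commute entropy and commute time: $H^c_{i,j} := H_{i,j} + H_{j,i}$ and $t^c_{i,j} := \mathbb{E}_i(\tau_j) + \mathbb{E}_j(\tau_i)$. Average entropy and average hitting time: $H^{av} := \sum_{i,j\in\mathcal{X}} \pi_i\pi_j H_{i,j}$ and $t^{av} := \sum_{i,j \in \mathcal{X}} \pi_i \pi_j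 \mathbb{E}_i(\tau_j)$. Reversible means $\pi_i P_{i,j} = \pi_j P_{j,i}$ for all $i,j \in \mathcal{X}$. Relaxation time, for reversible $X$: $t^{rel} := \frac{1}{1-\lambda_2}$, where $1 = \lambda_1 > \lambda_2 \geq \ldots \geq \lambda_n$ are the eigenvalues of $P$ (with multiplicity) in non-increasing order and $n := |\mathcal{X}|$. *)

(* Defs.v *)
From HB Require Import structures.
From mathcomp Require Import all_boot all_order all_algebra.
From mathcomp Require Import all_classical all_reals all_analysis.

Set Implicit Arguments.
Unset Strict Implicit.
Unset Printing Implicit Defensive.

Import Order.TTheory GRing.Theory Num.Theory.
Import numFieldNormedType.Exports.

Local Open Scope classical_set_scope.
Local Open Scope ring_scope.

Section TransitionMatrix.
Variables (R : realType) (S : finType).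
Implicit Types (P : S -> S -> R) (pi : S -> R) (i j : S).

Definition stochastic P : Prop :=
  (forall i j, 0 <= P i j) /\ (forall i, \sum_j P i j = 1).

Fixpoint nstep P (n : nat) i j : R :=
  if n is m.+1 then \sum_k P i k * nstep P m k j else (i == j)%:R.

Definition irreducible_chain P : Prop :=
  forall i j, exists n : nat, 0 < nstep P n i j.

Definition stationary P pi : Prop :=
  [/\ forall i, 0 <= pi i, \sum_i pi i = 1 &
      forall j, \sum_i pi i * P i j = pi j].

Definition reversible P pi : Prop :=
  forall i j, pi i * P i j = pi j * P j i.

(* The convention 0 log 0 = 0 holds here because of the factor 0. *)
Definition row_entropy P i : R := - \sum_j P i j * ln (P i j).

Definition constant_row_entropy P : Prop :=
  forall i j, row_entropy P i = row_entropy P j.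

Definition entropy_rate P pi : R :=
  - \sum_i \sum_j pi i * P i j * ln (P i j).

(* A trajectory i x_1 ... x_{k-1} j is encoded by the sequence
   [:: x_1; ...; x_{k-1}] of its intervening states. *)
Definition trajectories j : set (seq S) := [set s | j \notin s].

Fixpoint traj_prob P i (s : seq S) j : R :=
  if s is x :: s' then P i x * traj_prob P x s' j else P i j.

(* For a stochastic P all terms are nonnegative, so that the unordered sum
   esum is meaningful; it takes its values in [0, +oo]. *)
Definition traj_entropy P i j : \bar R :=
  \esum_(s in trajectories j)
    (- (traj_prob P i s j * ln (traj_prob P i s j)))%:E.

Definition commute_entropy P i j : \bar R :=
  (traj_entropy P i j + traj_entropy P j i)%E.

Definition average_entropy P pi : \bar R :=
  (\sum_i \sum_j (pi i * pi j)%:E * traj_entropy P i j)%E.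

Definition transition_mx P : 'M[R]_#|S| :=
  \matrix_(i, j) P (enum_val i) (enum_val j).

(* The eigenvalues of P, with multiplicity, in non-increasing order. Such a
   sequence is unique if it exists; it exists when P is reversible with respect
   to a positive pi, the only case in which it is used. *)
Definition eigenvalues P : seq R :=
  xget [::] [set s : seq R | sorted >=%R s /\
    char_poly (transition_mx P) = \prod_(a <- s) ('X - a%:P)].

(* Indices start at 0: the second largest eigenvalue is (eigenvalues P)`_1. *)
Definition relaxation_time P : R := (1 - (eigenvalues P)`_1)^-1.

End TransitionMatrix.

Section Process.
Variables (R : realType) (S : finType).
Variables (d : measure_display) (Omega : measurableType d).
Implicit Types (P : S -> S -> R) (pi : S -> R) (i j : S).
Implicit Types (mu : probability Omega R) (Pr : S -> probability Omega R).
Implicit Types (X : nat -> Omega -> S).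

Definition cylinder X (n : nat) (x : nat -> S) : set Omega :=
  [set w | forall k, (k <= n)%N -> X k w = x k].

(* The last clause is the homogeneous Markov property
     mu(X_{n+1} = x_{n+1} | X_0 = x_0, ..., X_n = x_n) = P x_n x_{n+1}
   multiplied by the probability of the conditioning event, hence without
   any proviso on null events. *)
Definition markov_chain P mu X : Prop :=
  (forall n i, measurable [set w | X n w = i]) /\
  (forall n (x : nat -> S),
     mu (cylinder X n.+1 x) = (mu (cylinder X n x) * (P (x n) (x n.+1))%:E)%E).

(* Pr i is the law under which the chain starts at i. *)
Definition markov_family P Pr X : Prop :=
  forall i, markov_chain P (Pr i) X /\ Pr i [set w | X 0%N w = i] = 1%E.

(* ereal_inf set0 = +oo. *)
Definition hitting_time X j (w : Omega) : \bar R :=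
  ereal_inf [set (n%:R)%:E | n in [set n : nat | X n w = j]].

Definition expected_hitting_time Pr X i j : \bar R :=
  (\int[Pr i]_w hitting_time X j w)%E.

Definition commute_time Pr X i j : \bar R :=
  (expected_hitting_time Pr X i j + expected_hitting_time Pr X j i)%E.

Definition average_hitting_time Pr X pi : \bar R :=
  (\sum_i \sum_j (pi i * pi j)%:E * expected_hitting_time Pr X i j)%E.

End Process.

(* Main.v *)
Require Import Defs.
From HB Require Import structures.
From mathcomp Require Import all_boot all_order all_algebra.
From mathcomp Require Import all_classical all_reals all_analysis.
From mathcomp Require Import lra.

Set Implicit Arguments.
Unset Strict Implicit.
Unset Printing Implicit Defensive.

Import Order.TTheory GRing.Theory Num.Theory.
Import numFieldNormedType.Exports.

Local Open Scope classical_set_scope.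
Local Open Scope ring_scope.

(** Write [h i] for the row entropies, [t i j] for the expected hitting times and
    [H i j] for the trajectory entropies. Splitting a trajectory at its first
    step, and using that trajectories to [j] have total probability [1], gives
    [H i j = h i + \sum_(k | k != j) P i k * H k j]; the times [t] obey the same
    system with [h] replaced by [1]. Both are finite because the killed Poisson
    equation has a finite nonnegative solution. Modulo its value at the target,
    [H i j] is thus a potential: [(I - P) H_j = h - (H(X) / pi j) \delta_j], and
    likewise [(I - P) t_j = 1 - \delta_j / pi j]. Suitable combinations of the two
    are harmonic, hence constant by the maximum principle; this yields the commute
    formula, [H = h t] off the diagonal when [h] is constant, and the random target
    lemma. Self-adjointness of [P] gives the cyclic tour identity.

    For the bounds by the relaxation time, let [W = P - 1 pi]. The matrix
    [Z i j = pi j (m j - t i j) + pi j], with [m j = \sum_i pi i t i j], is the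
    inverse of [I - W] and has trace [t^av + 1]. In the reversible case [W] is
    diagonalizable over the reals and its spectrum is that of [P] with one
    eigenvalue [1] replaced by [0], so [t^av] is the sum of [1 / (1 - lambda)] over
    the other eigenvalues of [P], all of which are smaller than [1]. *)

(** * Potential theory of an irreducible chain *)

Section Potential.
Variables (R : realType) (S : finType) (P : S -> S -> R).
Hypotheses (hP : stochastic P) (hirr : irreducible_chain P).

Lemma nstep_ge0 n i j : 0 <= nstep P n i j.
Proof.
elim: n i => [|n IH] i /=; first exact: ler0n.
by apply: sumr_ge0 => k _; rewrite mulr_ge0//; case: hP.
Qed.

(* Propagation of a maximum along paths, stopped on reaching j. *)
Lemma subharmonic_le (j : S) (f : S -> R) :
  (forall i, i != j -> f i <= \sum_k P i k * f k) -> forall i, f i <= f j.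
Proof.
move=> hf i; have [P0 P1] := hP.
pose m := [arg max_(x > i) f x]%O.
have fm k : f k <= f m.
  by rewrite /m; case: arg_maxP => //= x _; apply.
suff: forall n x, f x = f m -> 0 < nstep P n x j -> f j = f m.
  by move=> H; have [n hn] := hirr m j; rewrite (H n m).
elim=> [|n IH] x fx /=.
  by case: eqP => [<- //|_]; rewrite ltxx.
move=> /gt_eqF/negbT hn.
have [xj|xj] := eqVneq x j; first by rewrite -xj.
have [k hk0 hk] : exists2 k, 0 < P x k & 0 < nstep P n k j.
  apply/not_exists2P => H; move/negP: hn; apply; apply/eqP.
  rewrite big1// => k _; have [/negP|/negP] := H k.
    by rewrite -leNgt => Pk; rewrite (_ : P x k = 0) ?mul0r//; apply/le_anti; rewrite Pk P0.
  rewrite -leNgt => Nk; rewrite (_ : nstep P n k j = 0) ?mulr0//.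
  by apply/le_anti; rewrite Nk nstep_ge0.
apply: (IH k) => //; apply/le_anti; rewrite fm /= -subr_le0.
rewrite -(pmulr_rle0 _ hk0).
have : \sum_k P x k * (f m - f k) <= 0.
  under eq_bigr do rewrite mulrBr.
  by rewrite sumrB -mulr_suml P1 mul1r -fx subr_le0 hf.
apply: le_trans; rewrite (bigD1 k)//= lerDl; apply: sumr_ge0 => l _.
by rewrite mulr_ge0// subr_ge0.
Qed.

Lemma harmonic_const (f : S -> R) :
  (forall i, f i = \sum_k P i k * f k) -> forall i j, f i = f j.
Proof.
move=> hf i j; apply/le_anti/andP; split; apply: subharmonic_le => k _;
  by rewrite -hf.
Qed.

Lemma harmonic_off_eq0 (j : S) (f : S -> R) : f j = 0 ->
  (forall i, i != j -> f i = \sum_k P i k * f k) -> forall i, f i = 0.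
Proof.
move=> fj hf i; apply/le_anti/andP; split.
  by rewrite -fj; apply: subharmonic_le => k kj; rewrite -hf.
rewrite -oppr_le0 -[X in _ <= X]oppr0 -fj.
apply: (@subharmonic_le j (fun k => - f k)) => k kj.
by rewrite hf// -sumrN; apply: ler_sum => l _; rewrite mulrN.
Qed.

(** With the row of [j] replaced by [u j = 0], this is a square linear system. Its kernel consists
    of functions harmonic off [j] and zero at [j], so the maximum principle makes it invertible. *)
Lemma poisson_solution (j : S) (b : S -> R) : exists u : S -> R,
  u j = 0 /\ forall i, i != j -> u i = b i + \sum_k P i k * u k.
Proof.
pose M : 'M[R]_#|S| := \matrix_(x, y) ((x == y)%:R -
  (if enum_val x == j then 0 else P (enum_val x) (enum_val y))).
have ME (u : 'cV[R]_#|S|) i : (M *m u) (enum_rank i) 0 =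
    u (enum_rank i) 0 -
    (if i == j then 0 else \sum_k P i k * u (enum_rank k) 0).
  rewrite mxE (reindex _ (onW_bij _ (@enum_rank_bij S)))/=.
  under eq_bigr do rewrite mxE !enum_rankK mulrBl.
  rewrite sumrB (bigD1 i)//= eqxx mul1r big1 ?addr0; last first.
    by move=> k ki; rewrite (inj_eq enum_rank_inj) eq_sym (negPf ki) mul0r.
  congr (_ - _); case: eqP => // _.
  by under eq_bigr do rewrite mul0r; rewrite big1.
have Mu : M \in unitmx.
  rewrite -unitmx_tr unitmxE unitfE; apply/det0P => -[v v0 vM].
  have {}vM : M *m v^T = 0 by apply: trmx_inj; rewrite trmx_mul trmxK trmx0.
  have H i := ME v^T i; rewrite vM in H.
  move/negP: v0; apply; apply/eqP/rowP => x; rewrite mxE -(enum_valK x).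
  pose f i := v 0 (enum_rank i).
  apply: (@harmonic_off_eq0 j f).
    by have /esym := H j; rewrite !mxE eqxx subr0.
  move=> i ij; have /esym/eqP := H i; rewrite !mxE (negPf ij) subr_eq0 => /eqP.
  by rewrite /f => ->; apply: eq_bigr => k _; rewrite mxE.
pose u := invmx M *m \col_x (if enum_val x == j then 0 else b (enum_val x)).
have Hu i : (M *m u) (enum_rank i) 0 = if i == j then 0 else b i.
  by rewrite mulKVmx// mxE enum_rankK.
exists (fun i => u (enum_rank i) 0); split.
  by have := Hu j; rewrite ME eqxx subr0.
by move=> i ij; have := Hu i; rewrite ME (negPf ij) => <-; rewrite subrK.
Qed.

(** The first-step equation is imposed at [j] too, so that [u j] is the cost of a return rather than
    [0]. Such a [u] later bounds truncated sums and thereby proves finiteness. *)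
Lemma poisson_supersolution (j : S) (b : S -> R) : (forall i, 0 <= b i) ->
  exists u : S -> R, (forall i, 0 <= u i) /\
    forall i, u i = b i + \sum_(k | k != j) P i k * u k.
Proof.
move=> b0; have [v [vj hv]] := poisson_solution j b.
have [P0 _] := hP.
have v0 i : 0 <= v i.
  rewrite -oppr_le0 -[X in _ <= X]oppr0 -vj.
  apply: (@subharmonic_le j (fun k => - v k)) => k kj.
  rewrite hv// opprD -sumrN.
  under [X in _ <= X]eq_bigr do rewrite mulrN.
  by rewrite gerDr oppr_le0.
exists (fun i => b i + \sum_k P i k * v k); split.
  by move=> i; rewrite addr_ge0// sumr_ge0// => k _; rewrite mulr_ge0.
move=> i; congr (_ + _); rewrite (bigD1 j)//= vj mulr0 add0r.
by apply: eq_bigr => k kj; rewrite -hv.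
Qed.

(** The difference [u - v], reset to [0] at [j], is harmonic off [j] and hence zero; the equations
    then recover [u - v] itself, including its value at [j]. *)
Lemma killed_poisson_unique (j : S) (b u v : S -> R) :
  (forall i, u i = b i + \sum_(k | k != j) P i k * u k) ->
  (forall i, v i = b i + \sum_(k | k != j) P i k * v k) ->
  u =1 v.
Proof.
move=> hu hv.
pose f i := if i == j then 0 else u i - v i.
have sumf i : \sum_k P i k * f k = u i - v i.
  rewrite (bigD1 j)//= {1}/f eqxx mulr0 add0r hu hv opprD addrACA subrr add0r.
  by rewrite -sumrB; apply: eq_bigr => k kj; rewrite /f (negPf kj) mulrBr.
have f0 : forall i, f i = 0.
  apply: (@harmonic_off_eq0 j); first by rewrite /f eqxx.
  by move=> i ij; rewrite sumf /f (negPf ij).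
move=> i; apply/eqP; rewrite -subr_eq0 -sumf big1// => k _.
by rewrite f0 mulr0.
Qed.

(** * Stationary law, hitting times and additive costs *)

Section Stationary.
Variables (pi : S -> R).
Hypothesis hpi : stationary P pi.

Lemma stationary_sumP (f : S -> R) :
  \sum_i pi i * (\sum_k P i k * f k) = \sum_k pi k * f k.
Proof.
have [_ _ pP] := hpi.
under eq_bigr do rewrite mulr_sumr.
rewrite exchange_big; apply: eq_bigr => k _.
by rewrite -pP mulr_suml; apply: eq_bigr => i _; rewrite mulrA.
Qed.

Lemma stationary_nstep n j : \sum_i pi i * nstep P n i j = pi j.
Proof.
elim: n => [|n IH] /=; last by rewrite stationary_sumP IH.
rewrite (bigD1 j)//= eqxx mulr1 big1 ?addr0// => i ij.
by rewrite (negPf ij) mulr0.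
Qed.

(** Some state carries mass, a path of positive probability brings part of it to [j], and [pi] is
    invariant under [nstep P n]. *)
Lemma stationary_gt0 j : 0 < pi j.
Proof.
have [p0 p1 _] := hpi.
have [i hi] : exists i, 0 < pi i.
  apply/not_existsP => H; have := oner_neq0 R; rewrite -p1 big1 ?eqxx//.
  by move=> i _; apply/le_anti; rewrite p0 andbT leNgt; apply/negP/H.
have [n hn] := hirr i j.
rewrite -(stationary_nstep n j) (bigD1 i)//=.
rewrite ltr_pwDl ?mulr_gt0//; apply: sumr_ge0 => k _.
by rewrite mulr_ge0// nstep_ge0.
Qed.

(* At the target the defect is determined by integrating against [pi]. *)
Lemma poisson_defect (j : S) (b u : S -> R) : u j = 0 ->
  (forall i, i != j -> u i = b i + \sum_k P i k * u k) ->
  forall i, u i - \sum_k P i k * u k =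
    b i - (i == j)%:R * ((\sum_k pi k * b k) / pi j).
Proof.
move=> uj hu i; have [->|ij] := eqVneq i j; last first.
  by rewrite hu// addrK mul0r subr0.
have pj := stationary_gt0 j; rewrite mul1r.
set d := u j - _.
have : \sum_i pi i * (u i - \sum_k P i k * u k) = 0.
  by under eq_bigr do rewrite mulrBr; rewrite sumrB stationary_sumP subrr.
rewrite (bigD1 j)//= -/d (eq_bigr (fun i => pi i * b i)); last first.
  by move=> k kj; rewrite [in LHS]hu// addrK.
set s := \sum_(_ | _) _ => E; rewrite (bigD1 j)//= -/s.
have -> : s = - (pi j * d) by apply/eqP; rewrite -addr_eq0 addrC E.
by rewrite -mulrBr mulrAC divff ?gt_eqF// mul1r subKr.
Qed.

Section Hitting.
Variable t : S -> S -> R.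
Hypothesis tj : forall j, t j j = 0.
Hypothesis ht : forall i j, i != j -> t i j = 1 + \sum_k P i k * t k j.

Lemma hitting_ge0 i j : 0 <= t i j.
Proof.
rewrite -oppr_le0 -[leRHS]oppr0 -(tj j).
apply: (@subharmonic_le j (fun k => - t k j)) => k kj.
under eq_bigr do rewrite mulrN.
by rewrite sumrN lerN2 ht// lerDr.
Qed.

(** The case [i = j] contains Kac's formula: the mean return time to [j] is [(pi j)^-1]. *)
Lemma hitting_defect i j :
  t i j - \sum_k P i k * t k j = 1 - (i == j)%:R / pi j.
Proof.
rewrite (@poisson_defect j (fun=> 1) (t^~ j))//; last by move=> k; exact: ht.
have [_ p1 _] := hpi.
by under eq_bigr do rewrite mulr1; rewrite p1 mul1r.
Qed.

(** Averaged over the target with weights [pi j], the defects [1 - (i == j)%:R / pi j] sum to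
    [1 - 1 = 0], so the average is harmonic in the starting point. *)
Lemma random_target i i' : \sum_j pi j * t i j = \sum_j pi j * t i' j.
Proof.
have [P0 P1] := hP; have [_ p1 _] := hpi.
apply: (@harmonic_const (fun i => \sum_j pi j * t i j)) => k.
apply/eqP; rewrite -subr_eq0; under [X in _ - X]eq_bigr do rewrite mulr_sumr.
rewrite exchange_big -sumrB /= (eq_bigr (fun j => pi j - (k == j)%:R)).
  rewrite sumrB p1 (bigD1 k)//= eqxx big1 ?addr0 ?subrr// => j.
  by rewrite eq_sym => /negPf ->.
move=> j _; have pj := stationary_gt0 j.
have -> : \sum_l P k l * (pi j * t l j) = pi j * \sum_l P k l * t l j.
  by rewrite mulr_sumr; apply: eq_bigr => l _; rewrite mulrCA.
by rewrite -mulrBr hitting_defect mulrBr mulr1 mulrCA divff ?gt_eqF ?mulr1.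
Qed.

(* Self-adjointness of [P] in [L^2(pi)], applied to the hitting times of
   [j] and [k]. *)
Lemma reversible_hitting_sym : reversible P pi -> forall j k,
  t k j - \sum_i pi i * t i j = t j k - \sum_i pi i * t i k.
Proof.
move=> hrev j k.
have H a b : \sum_i pi i * t i a * (t i b - \sum_l P i l * t l b) =
    \sum_i pi i * t i a - t b a.
  under eq_bigr do rewrite hitting_defect mulrBr mulr1.
  rewrite sumrB; congr (_ - _); rewrite (bigD1 b)//= eqxx big1 ?addr0; last first.
    by move=> i ib; rewrite (negPf ib) mul0r mulr0.
  by rewrite div1r mulrAC divff ?mul1r// gt_eqF ?stationary_gt0.
apply: oppr_inj; rewrite !opprB -!H.
under eq_bigr do rewrite mulrBr; under [RHS]eq_bigr do rewrite mulrBr.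
rewrite !sumrB; congr (_ - _); first by apply: eq_bigr => i _; lra.
under eq_bigr do rewrite mulr_sumr; under [RHS]eq_bigr do rewrite mulr_sumr.
rewrite exchange_big/=; apply: eq_bigr => i _; apply: eq_bigr => l _.
by rewrite mulrACA -hrev [RHS]mulrACA [t l _ * _]mulrC.
Qed.

(** Each [t k j - t j k] is a difference of stationary averages, and around a cycle these
    differences telescope. *)
Lemma cyclic_tour : reversible P pi -> forall i j k,
  t i j + t j k + t k i = t i k + t k j + t j i.
Proof.
move=> hrev i j k.
have := reversible_hitting_sym hrev i j.
have := reversible_hitting_sym hrev j k.
have := reversible_hitting_sym hrev k i.
by lra.
Qed.

Section Cost.
Variables (h : S -> R) (H : S -> S -> R).
Hypothesis hH : forall i j, H i j = h i + \sum_(k | k != j) P i k * H k j.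
Let Hbar := \sum_i pi i * h i.
(** [H j j] is the cost of a return to [j]; resetting it to [0] gives a potential to which
    [poisson_defect] applies. *)
Let u i j := if i == j then 0 else H i j.

Let sum_u i j : \sum_k P i k * u k j = \sum_(k | k != j) P i k * H k j.
Proof.
rewrite (bigD1 j)//= {1}/u eqxx mulr0 add0r.
by apply: eq_bigr => k kj; rewrite /u (negPf kj).
Qed.

Let u_defect i j : u i j - \sum_k P i k * u k j = h i - (i == j)%:R * (Hbar / pi j).
Proof.
apply: (@poisson_defect j h (u^~ j)); first by rewrite /u eqxx.
by move=> k kj; rewrite sum_u /u (negPf kj) hH.
Qed.

Lemma return_cost j : H j j = Hbar / pi j.
Proof.
have := u_defect j j; rewrite sum_u {1}/u eqxx mul1r hH; lra.
Qed.

(** Between the potentials of [j] and [i] the source [h] cancels, leaving point masses that the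
    hitting times reproduce up to the factor [Hbar]. Hence [f] is harmonic, and [f i = f j] is the
    formula. *)
Lemma commute_cost i j : i != j -> H i j + H j i = (t i j + t j i) * Hbar.
Proof.
move=> ij.
pose f k := u k j - u k i - Hbar * (t k j - t k i).
have : f i = f j.
  apply: harmonic_const => k; apply/eqP; rewrite -subr_eq0.
  have -> : \sum_l P k l * f l = \sum_l P k l * u l j - \sum_l P k l * u l i
     - Hbar * (\sum_l P k l * t l j - \sum_l P k l * t l i).
    rewrite -!sumrB mulr_sumr -sumrB; apply: eq_bigr => l _; rewrite /f; lra.
  apply/eqP; have := (u_defect k i, u_defect k j, hitting_defect k i, hitting_defect k j).
  move=> [[[]]]; rewrite /f; nra.
rewrite /f /u !eqxx (negPf ij) eq_sym (negPf ij) !tj; lra.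
Qed.

(** Here [Hbar = c], so [u] and [c * t] have the same defect and both vanish at the target. The
    indicator term restores the return cost on the diagonal. *)
Lemma constant_cost c : (forall i, h i = c) ->
  forall i j, H i j = c * (t i j + (i == j)%:R / pi j).
Proof.
move=> hc.
have Hc : Hbar = c.
  have [_ p1 _] := hpi.
  by rewrite /Hbar; under eq_bigr do rewrite hc; rewrite -mulr_suml p1 mul1r.
move=> i j; have [->|ij] := eqVneq i j.
  by rewrite tj add0r mul1r return_cost Hc.
rewrite mul0r addr0.
pose f k := u k j - c * t k j.
have : f i = f j.
  apply: harmonic_const => k; apply/eqP; rewrite -subr_eq0.
  have -> : \sum_l P k l * f l = \sum_l P k l * u l j - c * \sum_l P k l * t l j.
    by rewrite mulr_sumr -sumrB; apply: eq_bigr => l _; rewrite /f; lra.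
  apply/eqP; have := (u_defect k j, hitting_defect k j).
  move=> []; rewrite Hc hc /f; nra.
rewrite /f /u eqxx (negPf ij) tj; lra.
Qed.

End Cost.
End Hitting.
End Stationary.
End Potential.

(** * Real symmetric matrices *)

Section SymmetricSpectral.
Variable R : realType.

Lemma quad_form_continuous n (A : 'M[R]_n) :
  continuous (fun v : 'rV[R]_n => (v *m A *m v^T) 0 0).
Proof.
rewrite (_ : (fun _ => _) = fun v : 'rV[R]_n =>
    \sum_j (\sum_i v 0 i * A i j) * v 0 j); last first.
  by apply/funext => v; rewrite mxE; apply: eq_bigr => j _; rewrite !mxE.
have H j : continuous (fun v : 'rV[R]_n => \sum_i v 0 i * A i j).
  apply: (continuous_big (op := +%R)); first exact: add_continuous.
  move=> i _ v; apply: continuousM; last exact: cst_continuous.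
  exact: coord_continuous.
apply: (continuous_big (op := +%R)); first exact: add_continuous.
by move=> j _ v; apply: continuousM; [exact: H|exact: coord_continuous].
Qed.

Lemma dot_sum_sqr n (v : 'rV[R]_n) : (v *m v^T) 0 0 = \sum_i v 0 i ^+ 2.
Proof. by rewrite mxE; apply: eq_bigr => i _; rewrite mxE. Qed.

Lemma dot_eq0 n (v : 'rV[R]_n) : ((v *m v^T) 0 0 == 0) = (v == 0).
Proof.
rewrite dot_sum_sqr psumr_eq0; last by move=> i _; exact: sqr_ge0.
apply/allP/eqP => [H|-> i _]; last by rewrite mxE expr0n /= eqxx.
by apply/rowP => i; rewrite mxE; have := H i (mem_index_enum i); rewrite sqrf_eq0 => /eqP.
Qed.

(* The eigenvector maximises the Rayleigh quotient on the unit sphere. *)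
Lemma symmetric_eigenvector n (A : 'M[R]_n.+1) : A^T = A ->
  exists (v : 'rV[R]_n.+1) (a : R), v *m v^T = 1%:M /\ v *m A = a *: v.
Proof.
move=> As.
pose q (B : 'M[R]_n.+1) (v : 'rV[R]_n.+1) := (v *m B *m v^T) 0 0.
pose N (v : 'rV[R]_n.+1) := (v *m v^T) 0 0.
have q1 v : q 1%:M v = N v by rewrite /q mulmx1.
pose sph := [set v | q 1%:M v = 1].
have sph_closed : closed sph.
  apply: (@preimage_closed _ _ (q 1%:M) [set 1]); last exact: closed_eq.
  by move=> v _; apply: quad_form_continuous.
have sph_compact : compact sph.
  apply: (@subclosed_compact _ _
    [set v : 'rV[R]_n.+1 | forall i, `[(- 1 : R), 1]%classic (v 0 i)]) => //.
    by apply: (@rV_compact _ _ (fun=> `[(- 1 : R), 1]%classic)) => _; exact: segment_compact.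
  move=> v; rewrite /sph/= q1 /N dot_sum_sqr => v1 i.
  rewrite in_itv/= -ler_norml -[leRHS]normr1 -ler_sqr ?nnegrE// !real_normK ?num_real//.
  rewrite expr1n -v1 (bigD1 i)//= lerDl; apply: sumr_ge0 => j _; exact: sqr_ge0.
have sph0 : sph !=set0.
  exists (delta_mx 0 0); rewrite /sph/= q1 /N trmx_delta mul_delta_mx.
  by rewrite mxE !eqxx.
have [v] := @compact_EVT_max _ R (q A) sph sph0 sph_compact
  (continuous_subspaceT (@quad_form_continuous _ A)).
rewrite inE /sph/= q1 => Nv hv.
exists v, (q A v); split.
  by apply/matrixP => i j; rewrite !ord1 -/(N v) Nv mxE eqxx.
set a := q A v.
have qa x : q A x <= a * N x.
  have [->|x0] := eqVneq x 0.
    by rewrite /q /N !mul0mx !mxE mulr0.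
  have Nx : 0 < N x.
    by rewrite lt_neqAle eq_sym dot_eq0 x0/= /N dot_sum_sqr sumr_ge0// => i _; exact: sqr_ge0.
  pose r := Num.sqrt (N x).
  have r2 : r ^+ 2 = N x by rewrite sqr_sqrtr// ltW.
  have rn0 : r != 0 by rewrite -sqrf_eq0 r2 gt_eqF.
  have scal B : q B (r^-1 *: x) = q B x / N x.
    by rewrite /q linearZ/= -!scalemxAl -scalemxAr !mxE mulrA -expr2 exprVn r2 mulrC.
  have : q A (r^-1 *: x) <= a.
    by apply: hv; rewrite inE /sph/= scal q1 divff// gt_eqF.
  by rewrite scal ler_pdivrMr.
have [w wE] : exists w, w = v *m A - a *: v by eexists.
have dotC (x y : 'rV[R]_n.+1) : (x *m y^T) 0 0 = (y *m x^T) 0 0.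
  by rewrite -[in LHS](trmxK x) -trmx_mul mxE.
have mxD (M M' : 'M[R]_1) : (M + M') 0 0 = M 0 0 + M' 0 0 by rewrite mxE.
have mxZ b (M : 'M[R]_1) : (b *: M) 0 0 = b * M 0 0 by rewrite mxE.
(* Moving from the maximiser [v] along the residual [w] cannot make [q A - a * N] positive; the
   linear term of this quadratic in [s] is [2 * s * N w], which will force [N w = 0]. *)
have hs s : 2 * s * N w + s ^+ 2 * (q A w - a * N w) <= 0.
  have := qa (v + s *: w); rewrite -subr_le0.
  suff -> : q A (v + s *: w) - a * N (v + s *: w) =
    2 * s * N w + s ^+ 2 * (q A w - a * N w) by [].
  have wT : (v + s *: w)^T = v^T + s *: w^T by rewrite linearD linearZ.
  have cross : (v *m A *m w^T) 0 0 = N w + a * (v *m w^T) 0 0.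
    have -> : v *m A = w + a *: v by rewrite wE subrK.
    by rewrite mulmxDl -scalemxAl mxD mxZ.
  have crossT : (w *m A *m v^T) 0 0 = (v *m A *m w^T) 0 0.
    by rewrite -mulmxA -[A *m _]trmxK dotC trmx_mul trmxK As -?trmx_mul ?trmxK.
  have -> : q A (v + s *: w) = a + 2 * s * (v *m A *m w^T) 0 0 + s ^+ 2 * q A w.
    rewrite /q wT !(mulmxDl, mulmxDr) -!(scalemxAl, scalemxAr) !(mxD, mxZ) crossT.
    rewrite /a /q; lra.
  have -> : N (v + s *: w) = 1 + 2 * s * (v *m w^T) 0 0 + s ^+ 2 * N w.
    rewrite /N wT !(mulmxDl, mulmxDr) -!(scalemxAl, scalemxAr) !(mxD, mxZ).
    by rewrite (dotC w v) -/(N v) Nv; lra.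
  rewrite cross; nra.
have Nw : N w = 0.
  have Nw0 : 0 <= N w by rewrite /N dot_sum_sqr sumr_ge0// => i _; exact: sqr_ge0.
  apply/le_anti; rewrite Nw0 andbT.
  set c := q A w - a * N w in hs.
  have [c0|c0] := leP 0 c; first by have := hs 1; nra.
  rewrite leNgt; apply/negP => Nwp.
  (* For [c < 0] this [s] is the vertex of the parabola, where its value [- (N w ^+ 2 / c)] is
     positive. *)
  have := hs (- N w / c); rewrite leNgt => /negP; apply.
  have -> : 2 * (- N w / c) * N w + (- N w / c) ^+ 2 * c = - (N w ^+ 2 / c).
    have Nk : N w = N w / c * c by rewrite divfK// lt_eqF.
    by rewrite mulNr sqrrN expr2 -[_ * c]mulrA -Nk; lra.
  by rewrite -mulrN -invrN divr_gt0 ?exprn_gt0// oppr_gt0.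
by move/eqP: Nw; rewrite dot_eq0 wE subr_eq0 => /eqP.
Qed.

(** The reflection in the hyperplane orthogonal to [v - e], with [e] the first basis vector,
    exchanges the unit vectors [v] and [e]. *)
Lemma householder n (v : 'rV[R]_n.+1) : v *m v^T = 1%:M ->
  exists H : 'M[R]_n.+1, [/\ H^T = H, H *m H = 1%:M & v *m H = delta_mx 0 0].
Proof.
move=> v1; set e : 'rV[R]_n.+1 := delta_mx 0 0.
have [->|ve] := eqVneq v e.
  by exists 1%:M; rewrite trmx1 !mulmx1.
pose w := v - e; pose c := (w *m w^T) 0 0.
have c0 : c != 0 by rewrite dot_eq0 subr_eq0.
have wc : w *m w^T = c%:M by rewrite [LHS]mx11_scalar.
have e1 : e *m e^T = 1%:M.
  by rewrite trmx_delta mul_delta_mx; apply/matrixP => i j; rewrite !ord1 !mxE !eqxx.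
have mxB (M M' : 'M[R]_1) : (M - M') 0 0 = M 0 0 - M' 0 0 by rewrite !mxE.
have m1 : (1%:M : 'M[R]_1) 0 0 = 1 by rewrite mxE eqxx.
have wT : w^T = v^T - e^T by rewrite linearB.
have vw : v *m w^T = (c / 2)%:M.
  rewrite [LHS]mx11_scalar; congr (_%:M).
  have ev : (e *m v^T) 0 0 = (v *m e^T) 0 0.
    by rewrite -[in LHS](trmxK e) -trmx_mul mxE.
  have : c = 1 - (v *m e^T) 0 0 - (e *m v^T) 0 0 + 1.
    by rewrite /c wT /w mulmxBl !mulmxBr v1 e1 !mxB m1; lra.
  by rewrite ev wT mulmxBr v1 mxB m1; lra.
have [G GE] : exists G, G = (2 / c) *: (w^T *m w) by eexists.
have GT : G^T = G by rewrite GE linearZ/= trmx_mul trmxK.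
have GG : G *m G = 2 *: G.
  rewrite {1}GE -scalemxAl GE -scalemxAr -mulmxA (mulmxA w) wc mul_scalar_mx.
  by rewrite -scalemxAr !scalerA divfK // mulrC.
have vG : v *m G = w.
  rewrite GE -scalemxAr mulmxA vw mul_scalar_mx scalerA mulrA divfK//.
  by rewrite divff ?pnatr_eq0// scale1r.
exists (1%:M - G); split.
- by rewrite linearB/= GT trmx1.
- rewrite mulmxBl mul1mx mulmxBr mulmx1 GG scaler_nat mulr2n opprB.
  by rewrite addrK subrK.
- by rewrite mulmxBr mulmx1 vG subKr.
Qed.

(** By induction on the size: a reflection moves a unit eigenvector to the first basis vector, which
    clears the first row and, by symmetry, the first column; a smaller symmetric block remains. *)
Theorem symmetric_diagonalizable n (A : 'M[R]_n) : A^T = A ->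
  exists (Q : 'M[R]_n) (D : 'rV[R]_n), Q \in unitmx /\ Q *m A = diag_mx D *m Q.
Proof.
elim: n A => [|n IH] A As.
  by exists 1%:M, 0; rewrite unitmx1; split => //; apply/matrixP => -[].
have [v [a [v1 va]]] := symmetric_eigenvector As.
have [H [HT HH vH]] := householder v1.
have [B BH] : exists B : 'M[R]_(1 + n), B = H *m A *m H by eexists.
have BT : B^T = B by rewrite BH !trmx_mul HT As mulmxA.
have B0 : (delta_mx 0 0 : 'rV[R]_(1 + n)) *m B = a *: delta_mx 0 0.
  rewrite -vH BH !mulmxA -(mulmxA v H) HH mulmx1 va scalemxAl.
  by rewrite -!scalemxAl.
have Bl j : B 0 j = a * (j == 0)%:R.
  by have := congr1 (fun M : 'rV_(1 + n) => M 0 j) B0; rewrite -rowE !mxE eqxx.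
have l0 : lshift n (0 : 'I_1) = 0 :> 'I_(1 + n) by apply: val_inj.
have BE : B = block_mx a%:M 0 0 (drsubmx B).
  rewrite -[LHS]submxK; congr block_mx; apply/matrixP => i j; rewrite !mxE ?ord1.
  - by rewrite l0 Bl eqxx mulr1 mulr1n.
  - by rewrite l0 Bl mulr0.
  - by rewrite -BT mxE l0 Bl mulr0.
have [Q [D [Qu QD]]] : exists (Q : 'M[R]_n) (D : 'rV[R]_n),
    Q \in unitmx /\ Q *m drsubmx B = diag_mx D *m Q.
  by apply: IH; rewrite trmx_drsub BT.
pose Q1 : 'M[R]_(1 + n) := block_mx 1%:M 0 0 Q.
have Q1u : Q1 \in unitmx by rewrite unitmxE det_ublock det1 mul1r -unitmxE.
have Q1D : Q1 *m B = diag_mx (row_mx a%:M D : 'rV[R]_(1 + n)) *m Q1.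
  rewrite BE /Q1 mulmx_block diag_mx_row mulmx_block.
  rewrite !mul0mx !mulmx0 !addr0 !add0r !mul1mx mulmx1 QD; congr block_mx.
  by apply/matrixP => i j; rewrite !mxE !ord1 eqxx.
exists (Q1 *m H), (row_mx a%:M D : 'rV[R]_(1 + n)); split.
  rewrite unitmx_mul; apply/andP; split; first exact: Q1u.
  by have [] := mulmx1_unit HH.
have -> : Q1 *m H *m A = Q1 *m B *m H.
  by rewrite BH -!mulmxA HH mulmx1.
by rewrite mulmxA; congr (_ *m H); exact: Q1D.
Qed.

End SymmetricSpectral.

(** * Characteristic polynomials and traces under similarity and deflation *)

Lemma char_poly_similar (F : fieldType) n (Q A B : 'M[F]_n) :
  Q \in unitmx -> Q *m A = B *m Q -> char_poly A = char_poly B.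
Proof.
move=> Qu E.
have Qn0 : \det (map_mx polyC Q) != 0.
  by rewrite det_map_mx polyC_eq0 -unitfE -unitmxE.
apply: (mulfI Qn0); rewrite [RHS]mulrC -!det_mulmx; congr (\det _).
rewrite /char_poly_mx mulmxBr mulmxBl -!map_mxM E.
by rewrite scalar_mxC.
Qed.

(* Wielandt deflation of the eigenvalue [1] with eigenvector [u]. *)
Lemma char_poly_deflate (F : fieldType) n (A : 'M[F]_n) (u : 'cV[F]_n)
    (v : 'rV[F]_n) : A *m u = u -> v *m u = 1%:M ->
  'X * char_poly A = ('X - 1) * char_poly (A - u *m v).
Proof.
move=> Au vu.
pose up := map_mx polyC u; pose vp := map_mx polyC v.
have vup : vp *m up = 1%:M by rewrite -map_mxM vu map_mx1.
(* The determinant of this bordered matrix is used twice. Clearing the lower left block leaves the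
   Schur complement, for [A - u *m v]. Clearing the upper right one, possible as [A *m u = u],
   exposes ['X * char_poly A] at the cost of a factor ['X - 1]. *)
pose M : 'M[{poly F}]_(n + 1) := block_mx (char_poly_mx A) (- up) vp 1%:M.
have dM : \det M = char_poly (A - u *m v).
  have dL : \det (block_mx 1%:M 0 (- vp) 1%:M : 'M[{poly F}]_(n + 1)) = 1.
    by rewrite det_lblock !det1 mulr1.
  rewrite -[LHS]mulr1 -dL -det_mulmx mulmx_block !mulmx1 !mulmx0 !add0r mul1mx subrr.
  rewrite det_ublock det1 mulr1; congr (\det _).
  by rewrite mulNmx mulmxN opprK /char_poly_mx map_mxB map_mxM opprB addrA addrAC.
have : \det (M *m block_mx 1%:M up 0 ('X - 1)%:M) = 'X * char_poly A.
  rewrite mulmx_block !mulmx1 !mulmx0 !addr0 mul1mx vup.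
  have -> : char_poly_mx A *m up + - up *m ('X - 1)%:M = 0.
    rewrite mul_mx_scalar scalerN /char_poly_mx mulmxBl -map_mxM Au mul_scalar_mx.
    by rewrite scalerBl scale1r subrr.
  rewrite det_lblock mulrC; congr (_ * _).
  by rewrite -raddfD/= addrC subrK det_scalar1.
move=> <-; rewrite det_mulmx det_ublock det1 mul1r det_scalar1 dM mulrC //.
Qed.

(** In the eigenbasis the diagonal of the hypothesis on [Z] reads [(1 - D 0 i) * Z' i i = 1], so no
    [1 - D 0 i] vanishes and [Z' i i] is its inverse. *)
Lemma trace_inverse_diag (F : fieldType) n (Q A Z : 'M[F]_n) (D : 'rV[F]_n) :
  Q \in unitmx -> Q *m A = diag_mx D *m Q -> (1%:M - A) *m Z = 1%:M ->
  \tr Z = \sum_i (1 - D 0 i)^-1.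
Proof.
move=> Qu E hZ.
pose Z' := Q *m Z *m invmx Q.
have -> : \tr Z = \tr Z' by rewrite /Z' mxtrace_mulC mulmxA mulVmx// mul1mx.
have Z'1 : (1%:M - diag_mx D) *m Z' = 1%:M.
  have -> : (1%:M - diag_mx D) *m Z' = Q *m ((1%:M - A) *m Z) *m invmx Q.
    by rewrite /Z' !mulmxA mulmxBl mul1mx -E mulmxBr mulmx1.
  by rewrite hZ mulmx1 mulmxV.
apply: eq_bigr => i _.
have := congr1 (fun M : 'M[F]_n => M i i) Z'1.
rewrite mulmxBl mul1mx mul_diag_mx !mxE eqxx -[X in X - _]mul1r -mulrBl => H.
have d0 : 1 - D 0 i != 0.
  by apply: contra_eq_neq H => ->; rewrite mul0r eq_sym oner_eq0.
by apply: (mulfI d0); rewrite H divff.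
Qed.

(** * Relaxation time *)

Section Relaxation.
Variables (R : realType) (S : finType) (P : S -> S -> R) (pi : S -> R).
Hypotheses (hP : stochastic P) (hirr : irreducible_chain P).
Hypotheses (hpi : stationary P pi) (hrev : reversible P pi).

(* For w >= 1 the positive part of such an f is subharmonic, hence constant. *)
Lemma centered_eigen_le0 (w : R) (f : S -> R) : 1 <= w ->
  \sum_i pi i * f i = 0 -> (forall i, \sum_k P i k * f k = w * f i) ->
  forall i, f i <= 0.
Proof.
move=> w1 pf Pf i; have [P0 _] := hP.
pose g k := Num.max (f k) 0.
have g0 k : 0 <= g k by rewrite le_max lexx orbT.
have fg k : f k <= g k by rewrite le_max lexx.
have gsub k : g k <= \sum_l P k l * g l.
  rewrite {1}/g ge_max; apply/andP; split; last first.
    by apply: sumr_ge0 => l _; rewrite mulr_ge0.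
  have [fk|fk] := leP (f k) 0.
    by apply: le_trans fk _; apply: sumr_ge0 => l _; rewrite mulr_ge0.
  apply: (@le_trans _ _ (w * f k)); first by rewrite ler_peMl// ltW.
  by rewrite -Pf; apply: ler_sum => l _; rewrite ler_wpM2l.
have gc k l : g k <= g l by apply: (subharmonic_le hP hirr) => m _.
rewrite leNgt; apply/negP => fi.
have fpos k : 0 < f k.
  have : 0 < g k by rewrite (lt_le_trans _ (gc i k))// lt_max fi.
  by rewrite lt_max ltxx orbF.
have := lt_irreflexive (0 : R); rewrite -[in X in _ < X]pf (bigD1 i)//=.
rewrite ltr_pwDl//.
  by rewrite mulr_gt0// (stationary_gt0 hP hirr hpi).
by apply: sumr_ge0 => k _; rewrite mulr_ge0 ?ltW// (stationary_gt0 hP hirr hpi).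
Qed.

(** Since [pi] is a left null vector of the deflated matrix, an eigenvector with [1 <= w] has mean
    [0] and is an eigenvector of [P]. The sign lemma for [f] and [- f] then yields [f = 0]. *)
Lemma deflated_eigen_lt1 (w : R) (f : S -> R) : (exists i, f i != 0) ->
  (forall i, \sum_k (P i k - pi k) * f k = w * f i) -> w < 1.
Proof.
move=> [i fi] Wf; rewrite ltNge; apply/negP => w1.
have [p0 p1 _] := hpi.
have pf : \sum_k pi k * f k = 0.
  have E : \sum_k pi k * (\sum_l (P k l - pi l) * f l) = 0.
    under eq_bigr do under eq_bigr do rewrite mulrBl.
    under eq_bigr do rewrite sumrB mulrBr.
    by rewrite sumrB (stationary_sumP hpi) -mulr_suml p1 mul1r subrr.
  have : w * \sum_k pi k * f k = 0.
    rewrite -[RHS]E mulr_sumr; apply: eq_bigr => k _; by rewrite Wf mulrCA.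
  by move/eqP; rewrite mulf_eq0 gt_eqF ?(lt_le_trans ltr01)//= => /eqP.
have Pf k : \sum_l P k l * f l = w * f k.
  by rewrite -Wf; under [RHS]eq_bigr do rewrite mulrBl; rewrite sumrB pf subr0.
move/negP: fi; apply; apply/eqP/le_anti.
rewrite (centered_eigen_le0 w1 pf Pf)/= -oppr_le0.
apply: (@centered_eigen_le0 w (fun k => - f k)) => //.
  by under eq_bigr do rewrite mulrN; rewrite sumrN pf oppr0.
by move=> k; under eq_bigr do rewrite mulrN; rewrite sumrN Pf mulrN.
Qed.

Let n := #|S|.
Let Pm : 'M[R]_n := transition_mx P.
Let u : 'cV[R]_n := const_mx 1.
Let v : 'rV[R]_n := \row_x pi (enum_val x).

Let sumE (F : S -> R) : \sum_(x < n) F (enum_val x) = \sum_i F i.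
Proof. by rewrite [RHS](reindex _ (onW_bij _ (@enum_val_bij S))). Qed.

(** By reversibility, conjugation by the diagonal matrix of the square roots of [pi] makes the
    deflated matrix symmetric. *)
Lemma deflated_diagonalizable : exists (Q : 'M[R]_n) (D : 'rV[R]_n),
  Q \in unitmx /\ Q *m (Pm - u *m v) = diag_mx D *m Q.
Proof.
pose s : 'rV[R]_n := \row_x Num.sqrt (pi (enum_val x)).
have pg := stationary_gt0 hP hirr hpi.
have s0 x : s 0 x != 0 by rewrite mxE sqrtr_eq0 -ltNge.
have s2 x : s 0 x * s 0 x = pi (enum_val x).
  by rewrite mxE -expr2 sqr_sqrtr// ltW.
pose W := Pm - u *m v.
have WE x y : W x y = P (enum_val x) (enum_val y) - pi (enum_val y).
  by rewrite !mxE big_ord1 !mxE mul1r.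
pose A := \matrix_(x, y) (s 0 x * W x y / s 0 y).
have As : A^T = A.
  apply/matrixP => x y; rewrite [LHS]mxE [LHS]mxE [RHS]mxE.
  have H a b : s 0 a * s 0 a * W a b = s 0 b * s 0 b * W b a.
    by rewrite !s2 !WE !mulrBr hrev [pi _ * pi _]mulrC.
  by apply/eqP; rewrite eqr_div//; apply/eqP; rewrite mulrAC H mulrAC.
have [Q [D [Qu QD]]] := symmetric_diagonalizable As.
exists (Q *m diag_mx s), D; split.
  rewrite unitmx_mul Qu unitmxE det_diag unitfE.
  by apply/prodf_neq0 => x _.
rewrite mulmxA -QD -!mulmxA; congr (_ *m _).
apply/matrixP => x y; rewrite mul_diag_mx mul_mx_diag [LHS]mxE [RHS]mxE.
by rewrite [A x y]mxE divfK.
Qed.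

Section Bounds.
Variable t : S -> S -> R.
Hypothesis tj : forall j, t j j = 0.
Hypothesis ht : forall i j, i != j -> t i j = 1 + \sum_k P i k * t k j.
Let tav := \sum_i \sum_j pi i * pi j * t i j.

(* The Kemeny-Snell fundamental matrix, expressed by hitting times. *)
Lemma fundamental_trace : exists Z : 'M[R]_n,
  (1%:M - (Pm - u *m v)) *m Z = 1%:M /\ \tr Z = tav + 1.
Proof.
have pg := stationary_gt0 hP hirr hpi.
have [_ p1 _] := hpi; have [_ P1] := hP.
pose m j := \sum_i pi i * t i j.
pose z i j := pi j * (m j - t i j) + pi j.
exists (\matrix_(x, y) z (enum_val x) (enum_val y)); split; last first.
  rewrite /mxtrace; under eq_bigr do rewrite mxE.
  rewrite (sumE (fun i => z i i)) big_split/= p1; congr (_ + _).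
  rewrite /tav exchange_big; apply: eq_bigr => j _.
  rewrite tj subr0 /m mulr_sumr; apply: eq_bigr => i _; by rewrite mulrCA mulrA.
apply/matrixP => x y; set i := enum_val x; set j := enum_val y.
rewrite mxE.
have -> : \sum_(k < n) (1%:M - (Pm - u *m v)) x k *
    (\matrix_(x, y) z (enum_val x) (enum_val y)) k y =
    \sum_(k < n) ((x == k)%:R * z (enum_val k) j) -
    \sum_(k < n) P i (enum_val k) * z (enum_val k) j +
    \sum_(k < n) pi (enum_val k) * z (enum_val k) j.
  rewrite -sumrB -big_split; apply: eq_bigr => k _.
  by rewrite !mxE big_ord1 !mxE /= -/i -/j; lra.
rewrite (sumE (fun k => P i k * z k j)) (sumE (fun k => pi k * z k j)).
rewrite (bigD1 x)//= eqxx mul1r big1 ?addr0; last first.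
  by move=> k; rewrite eq_sym => /negPf ->; rewrite mul0r.
have -> : \sum_k pi k * z k j = pi j.
  have -> : \sum_k pi k * z k j = \sum_k (pi j * (m j + 1) * pi k - pi j * (pi k * t k j)).
    by apply: eq_bigr => k _; rewrite /z; lra.
  by rewrite sumrB -!mulr_sumr p1 -/(m j); lra.
have -> : \sum_k P i k * z k j = pi j * (m j + 1) - pi j * \sum_k P i k * t k j.
  have -> : \sum_k P i k * z k j = \sum_k (pi j * (m j + 1) * P i k - pi j * (P i k * t k j)).
    by apply: eq_bigr => k _; rewrite /z; lra.
  by rewrite sumrB -!mulr_sumr P1; lra.
have := hitting_defect hP hirr hpi tj ht i j.
rewrite mxE (_ : (x == y) = (i == j)); last by rewrite (inj_eq enum_val_inj).
rewrite -/i => E.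
have -> : z i j - (pi j * (m j + 1) - pi j * (\sum_k P i k * t k j)) + pi j =
   pi j - pi j * (t i j - \sum_k P i k * t k j).
  by rewrite /z; lra.
by rewrite E mulrBr mulr1 subKr mulrCA divff ?mulr1// gt_eqF.
Qed.

(** The sum of [(1 - a)^-1] over the [#|S| - 1] eigenvalues other than the top one has positive
    terms, the largest of which comes from the second eigenvalue. *)
Lemma hitting_relaxation : (2 <= #|S|)%N ->
  relaxation_time P <= tav <= (#|S|%:R - 1) * relaxation_time P.
Proof.
move=> n2.
have [Q [D [Qu QD]]] := deflated_diagonalizable.
have [Z [hZ trZ]] := fundamental_trace.
have [_ p1 _] := hpi; have [_ P1] := hP.
have Du : Pm *m u = u.
  apply/matrixP => x y; rewrite !mxE -[RHS](P1 (enum_val x)) -sumE.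
  by apply: eq_bigr => k _; rewrite !mxE mulr1.
have vu : v *m u = 1%:M.
  apply/matrixP => x y; rewrite !ord1 !mxE eqxx -[RHS]p1 -sumE.
  by apply: eq_bigr => k _; rewrite !mxE mulr1.
have D1 x : D 0 x < 1.
  pose c := invmx Q *m delta_mx x (0 : 'I_1).
  have Wc : (Pm - u *m v) *m c = D 0 x *: c.
    apply: (can_inj (mulKmx Qu)); rewrite mulmxA QD -mulmxA /c mulKVmx//.
    rewrite -scalemxAr mulKVmx//; apply/matrixP => y z.
    rewrite mul_diag_mx !mxE; case: eqVneq => [->//|_]; by rewrite !mulr0.
  apply: (@deflated_eigen_lt1 _ (fun i => c (enum_rank i) 0)).
    apply/not_existsP => c0; have : c = 0.
      apply/matrixP => y z; rewrite ord1 [RHS]mxE -[y]enum_valK.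
      by apply/eqP; apply: contra_notT (c0 (enum_val y)).
    move/(congr1 (mulmx Q)); rewrite mulmx0 mulKVmx// => /matrixP/(_ x 0).
    by rewrite !mxE !eqxx => /eqP; rewrite oner_eq0.
  move=> i; have /matrixP/(_ (enum_rank i) 0) := Wc.
  rewrite [RHS]mxE => <-; rewrite mxE -(sumE (fun k => (P i k - pi k) * c (enum_rank k) 0)).
  apply: eq_bigr => k _; rewrite !mxE big_ord1 !mxE mul1r enum_rankK.
  by rewrite enum_valK.
pose ds := [seq D 0 x | x <- index_enum 'I_n].
have cW : char_poly (Pm - u *m v) = \prod_(a <- ds) ('X - a%:P).
  rewrite (char_poly_similar Qu QD) char_poly_trig; last first.
    by apply/is_trig_mxP => x y xy; rewrite !mxE -val_eqE ltn_eqF.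
  by rewrite big_map; apply: eq_bigr => x _; rewrite !mxE eqxx.
have cP := char_poly_deflate Du vu; rewrite cW in cP.
have ds1 a : a \in ds -> a < 1 by move=> /mapP[x _ ->].
have X0 : 'X = 'X - (0 : R)%:P by rewrite subr0.
(* At [0] the left side of the deflation identity vanishes while ['X - 1] does not. Below, [es] is
   the deflated spectrum with one copy of [0] removed. *)
have : 0 \in ds.
  have : root ('X * char_poly Pm) 0 by rewrite rootM rootX eqxx.
  rewrite cP rootM -[1]/(1%:P) root_XsubC eq_sym oner_eq0/=.
  by rewrite root_prod_XsubC.
move=> /perm_to_rem dsP; set es := rem 0 ds in dsP.
have cP1 : char_poly Pm = \prod_(a <- 1 :: es) ('X - a%:P).
  apply: (@mulfI _ 'X); first by rewrite polyX_eq0.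
  by rewrite cP (perm_big _ dsP) !big_cons/= subr0 mulrCA.
have [s_sorted s_char] : sorted >=%R (eigenvalues P) /\
    char_poly Pm = \prod_(a <- eigenvalues P) ('X - a%:P).
  (* Sorting [1 :: es] gives an admissible list, so [xget] does not fall back on its default. *)
  rewrite /eigenvalues; case: xgetP => [s -> //|/(_ (sort >=%R (1 :: es)))] [].
  split; first by apply: sort_sorted => a b; exact: le_total.
  by rewrite -/Pm cP1; apply: perm_big; rewrite perm_sym perm_sort.
have sP : perm_eq (eigenvalues P) (1 :: es).
  by apply: prod_XsubC_eq; rewrite -s_char cP1.
have es1 a : a \in es -> a < 1.
  by move=> ae; apply: ds1; rewrite (perm_mem dsP) inE ae orbT.
have se : size es = n.-1.
  by have := perm_size dsP; rewrite size_map -[index_enum _]enumT size_enum_ord => ->.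
have tavE : tav = \sum_(a <- es) (1 - a)^-1.
  apply: (addIr 1); rewrite -trZ (trace_inverse_diag Qu QD hZ).
  have -> : \sum_i (1 - D 0 i)^-1 = \sum_(a <- ds) (1 - a)^-1 by rewrite big_map.
  by rewrite (perm_big _ dsP) big_cons /= subr0 invr1 addrC.
case sE : (eigenvalues P) => [|x1 es'].
  by move: sP; rewrite sE => /perm_size.
have x1E : x1 = 1.
  have /orP[/eqP//|/es1 x11] : x1 \in 1 :: es.
    by rewrite -(perm_mem sP) sE mem_head.
  have : 1 \in x1 :: es' by rewrite -sE (perm_mem sP) mem_head.
  rewrite inE => /orP[/eqP//|].
  move: s_sorted; rewrite sE /= => /(order_path_min ge_trans)/allP H /H /=.
  by rewrite leNgt x11.
have {sP}sP : perm_eq es' es by move: sP; rewrite sE x1E perm_cons.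
have es'1 a : a \in es' -> a < 1 by rewrite (perm_mem sP); exact: es1.
rewrite tavE -(perm_big _ sP)/= /relaxation_time sE /=.
have : size es' = n.-1 by rewrite (perm_size sP).
(* An empty [es'] would mean [#|S| <= 1]; hence index [1] in [relaxation_time] reads a genuine
   eigenvalue and not the default [0]. *)
case: es' sE es'1 {sP} => [_ _ /= n0|x2 es' sE es'1 /= sn].
  by move: n2; rewrite -/n; case: (n) n0 => [//|[]].
have x2P : 0 < (1 - x2)^-1 by rewrite invr_gt0 subr_gt0 es'1 ?mem_head.
apply/andP; split.
  rewrite big_cons lerDl big_seq; apply: sumr_ge0 => a ae.
  by rewrite invr_ge0 subr_ge0 ltW// es'1// inE ae orbT.
have -> : #|S|%:R - 1 = (size (x2 :: es'))%:R :> R.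
  by rewrite /= sn -/n -[X in X%:R - _](prednK (ltnW n2)) -natr1 addrK.
rewrite -sum1_size natr_sum mulr_suml big_seq [leRHS]big_seq.
apply: ler_sum => a ae; rewrite mul1r lef_pV2 ?posrE ?subr_gt0 ?es'1 ?mem_head//.
rewrite lerD2l lerN2; move: ae; rewrite inE => /orP[/eqP->//|ae].
move: s_sorted; rewrite sE /= => /andP[_ /(order_path_min ge_trans)/allP]; exact.
Qed.

End Bounds.
End Relaxation.

(** * Entropy of trajectories *)

Section EsumSeq.
Variables (R : realType) (S : finType).
Local Open Scope ereal_scope.

Lemma esumZl (T : choiceType) (D : set T) (c : R) (a : T -> \bar R) :
  (0 <= c)%R -> (forall s, 0 <= a s) ->
  \esum_(s in D) (c%:E * a s) = c%:E * \esum_(s in D) a s.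
Proof.
move=> c0 a0.
have le (b : R) (f : T -> \bar R) : (0 <= b)%R -> (forall s, 0 <= f s) ->
    \esum_(s in D) (b%:E * f s) <= b%:E * \esum_(s in D) f s.
  move=> b0 f0; apply: ge_ereal_sup => _ [X [finX XD] <-].
  rewrite -ge0_mule_fsumr// lee_wpmul2l ?lee_fin//.
  by apply: ereal_sup_ubound; exists X.
have [->|cn0] := eqVneq c 0%R.
  by rewrite mul0e esum1// => s _; rewrite mul0e.
apply/le_anti; rewrite le//=.
have := le c^-1%R (fun s => c%:E * a s); rewrite invr_ge0 c0 => /(_ isT).
move=> /(_ (fun s => mule_ge0 _ (a0 s))); rewrite lee_fin => /(_ c0).
under eq_esum do rewrite muleA -EFinM mulVf// mul1e.
move=> H; apply: (@le_trans _ _ (c%:E * (c^-1%:E * \esum_(s in D) (c%:E * a s)))).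
  by rewrite lee_wpmul2l ?lee_fin.
by rewrite muleA -EFinM divff// mul1e.
Qed.

(** A finite set of sequences has bounded length, so each finite partial sum is already counted in
    some truncation. *)
Lemma esum_le_truncated (D : set (seq S)) (a : seq S -> \bar R) (c : \bar R) :
  (forall n, \esum_(s in [set s | D s /\ (size s < n)%N]) a s <= c) ->
  \esum_(s in D) a s <= c.
Proof.
move=> H; apply: ge_ereal_sup => _ [X [finX XD] <-].
apply: le_trans (H (\max_(s <- finmap.enum_fset (fset_set X)) size s)%N.+1).
apply: ereal_sup_ubound; exists X => //; split => // s Xs; split; first exact: XD.
by rewrite ltnS; apply: leq_bigmax_seq => //; rewrite in_fset_set// inE.
Qed.

Lemma esum_seq_recl (D : set (seq S)) (a : seq S -> \bar R) :
  (forall s, 0 <= a s) -> D [::] ->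
  \esum_(s in D) a s =
  a [::] + \sum_k \esum_(s in [set s | D (k :: s)]) a (k :: s).
Proof.
move=> a0 D0.
pose Dk k := [set k :: s | s in [set s | D (k :: s)]].
have -> : \sum_k \esum_(s in [set s | D (k :: s)]) a (k :: s) =
    \sum_k \esum_(s in setT) (if s \in Dk k then a s else 0).
  apply: eq_bigr => k _; rewrite -esum_mkcond esum_image//.
  by move=> s s' _ _ [].
have -> : a [::] = \esum_(s in setT) (if s \in [set [::]] then a s else 0).
  by rewrite -esum_mkcond esum_set1.
rewrite -esum_sum; last by move=> s k _ _; case: ifP.
rewrite -esumD; last 2 first.
- by move=> s _; case: ifP.
- by move=> s _; apply: sume_ge0 => k _; case: ifP.
rewrite esum_mkcond; apply: eq_esum => -[|k s] _.
  rewrite big1 ?adde0; last first.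
    by move=> k _; case: ifPn => //; rewrite inE => -[s _].
  by rewrite !ifT ?inE.
rewrite [X in _ = X + _]ifF ?add0e; last by apply/negP => /set_mem.
rewrite (bigD1 k)//= big1 ?adde0; last first.
  move=> l lk; rewrite ifF//; apply/negP; rewrite inE => -[s' _ [lE _]].
  by rewrite lE eqxx in lk.
have -> : (k :: s \in D) = (k :: s \in Dk k); last by [].
apply/idP/idP; rewrite !inE; first by move=> ?; exists s.
by move=> [s' ? [<-]].
Qed.

End EsumSeq.

Lemma entropy_term_ge0 (R : realType) (x : R) :
  0 <= x <= 1 -> 0 <= - (x * ln x).
Proof. by move=> /andP[x0 x1]; rewrite -mulrN mulr_ge0// oppr_ge0 ln_le0. Qed.

Lemma entropy_termM (R : realType) (x y : R) : 0 <= x -> 0 <= y ->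
  - (x * y * ln (x * y)) = - (x * ln x) * y + x * - (y * ln y).
Proof.
rewrite !le_eqVlt => /orP[/eqP<-|x0]; first by move=> _; rewrite !mul0r oppr0 mul0r addr0.
move=> /orP[/eqP<-|y0]; first by rewrite !mulr0 !mul0r oppr0 mulr0 addr0.
rewrite lnM ?posrE//; lra.
Qed.

Section TrajectoryEntropy.
Variables (R : realType) (S : finType) (P : S -> S -> R).
Hypotheses (hP : stochastic P) (hirr : irreducible_chain P).

Lemma stochastic_itv i k : 0 <= P i k <= 1.
Proof.
have [P0 P1] := hP; rewrite P0 -(P1 i) (bigD1 k)//= lerDl.
by apply: sumr_ge0 => l _.
Qed.

Lemma row_entropy_ge0 i : 0 <= row_entropy P i.
Proof.
rewrite /row_entropy -sumrN; apply: sumr_ge0 => k _.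
exact/entropy_term_ge0/stochastic_itv.
Qed.

(* Gibbs' inequality against the uniform law. *)
Lemma row_entropy_le_ln_card i : row_entropy P i <= ln #|S|%:R.
Proof.
have [P0 P1] := hP.
have n0 : 0 < #|S|%:R :> R by rewrite ltr0n; apply/card_gt0P; exists i.
rewrite -subr_le0; set L := ln #|S|%:R.
rewrite -[L]mul1r -(P1 i) mulr_suml /row_entropy -opprD -big_split /=.
rewrite oppr_le0.
have S0 : \sum_(k : S) (P i k - #|S|%:R^-1) = 0.
  by rewrite sumrB P1 sumr_const -[_^-1 *+ _]mulr_natr mulVf ?gt_eqF// subrr.
rewrite -[leLHS]S0; apply: ler_sum => k _.
have := P0 i k; rewrite le_eqVlt => /orP[/eqP<-|Pk].
  by rewrite !mul0r addr0 sub0r oppr_le0 invr_ge0 ltW.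
have xp : 0 < (#|S|%:R * P i k)^-1 by rewrite invr_gt0 mulr_gt0.
(* This is [ln (1 + x) <= x] with [1 + x] the ratio of the uniform probability to [P i k]. *)
have := @le_ln1Dx R ((#|S|%:R * P i k)^-1 - 1).
rewrite ltrBrDl subrr => /(_ xp); rewrite addrCA subrr addr0.
rewrite lnV ?posrE ?mulr_gt0// lnM ?posrE// => H.
have : P i k * (- (ln #|S|%:R + ln (P i k))) <=
    P i k * ((#|S|%:R * P i k)^-1 - 1) by rewrite ler_wpM2l// ltW.
rewrite invfM mulrBr mulrCA divff ?gt_eqF// mulr1 -/L; lra.
Qed.

Lemma traj_prob_itv i s j : 0 <= traj_prob P i s j <= 1.
Proof.
elim: s i => [|x s IH] i /=; first exact: stochastic_itv.
have /andP[a0 a1] := stochastic_itv i x; have /andP[b0 b1] := IH x.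
by rewrite mulr_ge0//= mulr_ile1.
Qed.

Variable j : S.
Let p i s := traj_prob P i s j.
Let e i s := - (p i s * ln (p i s)).
Let p0 i s : 0 <= p i s. Proof. by have /andP[] := traj_prob_itv i s j. Qed.
Let e0 i s : 0 <= e i s. Proof. exact/entropy_term_ge0/traj_prob_itv. Qed.

Local Open Scope ereal_scope.

Let F (D : set (seq S)) i := \esum_(s in D) (p i s)%:E.
Let E (D : set (seq S)) i := \esum_(s in D) (e i s)%:E.

Let F0 D i : 0 <= F D i. Proof. by apply: esum_ge0 => s _; rewrite lee_fin. Qed.
Let E0 D i : 0 <= E D i. Proof. by apply: esum_ge0 => s _; rewrite lee_fin. Qed.

(* [D'] is what remains of [D] after a first step that does not hit [j]. *)
Let step D D' := D [::] /\ forall k s, D (k :: s) <-> k != j /\ D' s.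

Let step_set D D' k : step D D' ->
  [set s | D (k :: s)] = if k != j then D' else set0.
Proof.
move=> [_ DD']; apply/seteqP; split => s /=.
  by move=> /DD'[kj]; rewrite kj.
by case: ifP => // kj Ds; apply/DD'.
Qed.

Let F_step D D' i : step D D' ->
  F D i = (P i j)%:E + \sum_(k | k != j) (P i k)%:E * F D' k.
Proof.
move=> st; have [D0 _] := st; have [P0 _] := hP.
rewrite /F esum_seq_recl// => [|s]; last by rewrite lee_fin.
congr (_ + _); rewrite [RHS]big_mkcond/=; apply: eq_bigr => k _.
rewrite (step_set k st); case: ifP => kj; last by rewrite esum_set0.
rewrite -esumZl//= => s; by rewrite lee_fin.
Qed.

(** The chain rule for entropy: the term of [k :: s] is the entropy of the first step weighted by
    the probability of the rest, plus [P i k] times the term of the rest. The weights sum to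
    [F D' k]. *)
Let E_step D D' i : step D D' ->
  E D i = (- (P i j * ln (P i j)))%:E +
    \sum_(k | k != j) ((- (P i k * ln (P i k)))%:E * F D' k + (P i k)%:E * E D' k).
Proof.
move=> st; have [D0 _] := st; have [P0 _] := hP.
rewrite /E esum_seq_recl// => [|s]; last by rewrite lee_fin.
congr (_ + _); rewrite [RHS]big_mkcond/=; apply: eq_bigr => k _.
rewrite (step_set k st); case: ifP => kj; last by rewrite esum_set0.
have h0 := entropy_term_ge0 (stochastic_itv i k).
rewrite -!esumZl//; try by move=> s; rewrite lee_fin.
rewrite -esumD; last 2 first.
- by move=> s _; rewrite -EFinM lee_fin mulr_ge0.
- by move=> s _; rewrite -EFinM lee_fin mulr_ge0.
apply: eq_esum => s _; rewrite -!EFinM -EFinD; congr (_%:E).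
rewrite /e /p /=; apply: entropy_termM; [exact: P0|exact: p0].
Qed.

(** Trajectories of at most [n] steps. Sums over them can be bounded by induction before the full
    sum is known to be finite. *)
Let T n := [set s : seq S | j \notin s /\ (size s < n)%N].

Let T0 : T 0 = set0. Proof. by apply/seteqP; split => // s []. Qed.

Let T_step n : step (T n.+1) (T n).
Proof.
split; first by [].
move=> k s; rewrite /T/= inE negb_or eq_sym ltnS.
by split => [[/andP[-> ->] ->]|[-> [-> ->]]].
Qed.

Let traj_step : step (trajectories j) (trajectories j).
Proof.
split; first by [].
move=> k s; rewrite /trajectories/= inE negb_or eq_sym.
by split => [/andP[-> ->]|[-> ->]].
Qed.

Let row_split i : (P i j + \sum_(k | k != j) P i k = 1)%R.
Proof. by have [_ P1] := hP; rewrite -(P1 i) [RHS](bigD1 j). Qed.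

Let FT_le1 n i : F (T n) i <= 1.
Proof.
elim: n i => [|n IH] i; first by rewrite /F T0 esum_set0.
rewrite (F_step _ (T_step n)) -(row_split i) EFinD leeD2l// -sumEFin.
apply: lee_sum => k _; rewrite -[leRHS]mule1 lee_wpmul2l ?lee_fin//.
by have [] := hP.
Qed.

(** Bounded through its truncations, the sum solves the killed Poisson equation with source [P i j];
    so does the constant [1], because rows sum to one. Uniqueness concludes. *)
Lemma traj_prob_sum1 i : \esum_(s in trajectories j) (p i s)%:E = 1.
Proof.
have Fle k : F (trajectories j) k <= 1.
  by apply: esum_le_truncated => n; exact: FT_le1.
have Ff k : (fine (F (trajectories j) k))%:E = F (trajectories j) k.
  by rewrite fineK// ge0_fin_numE// (le_lt_trans (Fle k))// ltry.
rewrite -/(F _ i) -Ff; congr (_%:E).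
apply: (killed_poisson_unique hP hirr (j := j) (b := fun i => P i j)
  (u := fun i => fine (F (trajectories j) i)) (v := fun=> 1%R)) => k.
  apply: EFin_inj; rewrite Ff (F_step _ traj_step) EFinD -sumEFin.
  by congr (_ + _); apply: eq_bigr => l _; rewrite EFinM Ff.
by under eq_bigr do rewrite mulr1; rewrite row_split.
Qed.

Let rowE i : (row_entropy P i = - (P i j * ln (P i j)) +
  \sum_(k | k != j) - (P i k * ln (P i k)))%R.
Proof. by rewrite /row_entropy -sumrN (bigD1 j). Qed.

(** The nonnegative solution [u] of the same equation dominates every truncated entropy, so the
    entropy is finite and [E_step] descends to the reals, its weights [F] being [1]. *)
Lemma traj_entropy_first_step : exists H : S -> R,
  forall i, traj_entropy P i j = (H i)%:E /\
    H i = (row_entropy P i + \sum_(k | k != j) P i k * H k)%R.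
Proof.
have [u [u0 hu]] := poisson_supersolution hP hirr j row_entropy_ge0.
have [P0 _] := hP.
have ETle n i : E (T n) i <= (u i)%:E.
  elim: n i => [|n IH] i; first by rewrite /E T0 esum_set0 lee_fin.
  rewrite (E_step _ (T_step n)) hu rowE -addrA EFinD leeD2l//.
  rewrite -big_split -sumEFin; apply: lee_sum => k _ /=; rewrite EFinD EFinM.
  apply: leeD; last by rewrite lee_wpmul2l ?lee_fin.
  rewrite -[leRHS]mule1 lee_wpmul2l ?FT_le1// lee_fin.
  exact/entropy_term_ge0/stochastic_itv.
have Ele i : E (trajectories j) i <= (u i)%:E.
  by apply: esum_le_truncated => n; exact: ETle.
have Ef i : (fine (E (trajectories j) i))%:E = E (trajectories j) i.
  by rewrite fineK// ge0_fin_numE// (le_lt_trans (Ele i))// ltry.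
exists (fun i => fine (E (trajectories j) i)) => i; split; first by rewrite Ef.
apply: EFin_inj; rewrite Ef (E_step _ traj_step) rowE -addrA EFinD; congr (_ + _).
rewrite -big_split -sumEFin; apply: eq_bigr => k _ /=.
by rewrite EFinD EFinM Ef /F traj_prob_sum1 mule1.
Qed.

End TrajectoryEntropy.

(** * Expected hitting times *)

Section HittingTime.
Variables (R : realType) (S : finType) (d : measure_display).
Variables (Omega : measurableType d) (P : S -> S -> R) (X : nat -> Omega -> S).

Lemma total_probability (mu : probability Omega R) (T : finType)
    (Y : Omega -> T) (B : set Omega) :
  (forall y, measurable (B `&` [set w | Y w = y])) ->
  mu B = (\sum_y mu (B `&` [set w | Y w = y]))%E.
Proof.
move=> mB.
have -> : (\sum_y mu (B `&` [set w | Y w = y]) =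
    \sum_(y \in [set: T]) mu (B `&` [set w | Y w = y]))%E.
  rewrite [LHS]fsbig_seq ?index_enum_uniq//; congr (\sum_(y \in _) _)%E.
  by apply/seteqP; split => y _ //=; rewrite mem_index_enum.
rewrite -measure_fin_bigcup//.
- congr (mu _); apply/seteqP; split => [w Bw|w [y _ []]//].
  by exists (Y w).
- exact: finite_finset.
- by move=> y y' _ _ [w [[_ <-] [_ <-]]].
Qed.

Lemma cylinder_measurable n (x : nat -> S) :
  (forall m i, measurable [set w | X m w = i]) -> measurable (cylinder X n x).
Proof.
move=> mX.
have -> : cylinder X n x = \bigcap_(k in `I_n.+1) [set w | X k w = x k].
  by apply/seteqP; split => w h k; exact: h.
by apply: fin_bigcap_measurable; [exact: finite_II|move=> k _; exact: mX].
Qed.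

(** * Markov property for past events and survival probabilities *)

Section Chain.
Variable mu : probability Omega R.
Hypothesis hmu : markov_chain P mu X.

Let mX n i : measurable [set w | X n w = i]. Proof. by case: hmu => H _; exact: H. Qed.

Section Past.
Variables (n : nat) (E : set Omega).
Hypothesis EX : forall w w', (forall k, (k <= n)%N -> X k w = X k w') ->
  E w -> E w'.
Let Y w : {ffun 'I_n.+1 -> S} := [ffun m : 'I_n.+1 => X m w].

Let YP w w' : Y w = Y w' <-> forall k, (k <= n)%N -> X k w = X k w'.
Proof.
split=> [/ffunP H k kn|H]; last first.
  by apply/ffunP => k; rewrite !ffunE H// -ltnS.
by have := H (Ordinal (kn : (k < n.+1)%N)); rewrite !ffunE.
Qed.

Let past_cylinder (y : {ffun 'I_n.+1 -> S}) :
  E `&` [set w | Y w = y] = set0 \/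
  exists2 w0, E w0 & E `&` [set w | Y w = y] = cylinder X n (fun m => X m w0).
Proof.
have [[w0 [Ew0 /= Yw0]]|/set0P/negP] := pselect ((E `&` [set w | Y w = y]) !=set0); last first.
  by rewrite negbK => /eqP; left.
right; exists w0 => //; apply/seteqP; split => w /=.
  by move=> [Ew]; rewrite -Yw0 => /YP.
move=> H; split; last by rewrite -Yw0; apply/YP.
by apply: EX Ew0 => k kn; rewrite H.
Qed.

Lemma past_measurable : measurable E.
Proof.
have -> : E = \bigcup_(y in [set: {ffun 'I_n.+1 -> S}]) (E `&` [set w | Y w = y]).
  by apply/seteqP; split => [w Ew|w [y _ []]//]; exists (Y w).
apply: fin_bigcup_measurable; first exact: finite_finset.
move=> y _; have [->|[w0 _ ->]] := past_cylinder y; first exact: measurable0.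
exact: cylinder_measurable.
Qed.

(** An event of the past is a finite disjoint union of cylinders; on each, the last clause of
    [markov_chain] applies to the path prolonged by [l]. *)
Lemma markov_past k l : (forall w, E w -> X n w = k) ->
  mu (E `&` [set w | X n.+1 w = l]) = (mu E * (P k l)%:E)%E.
Proof.
move=> Ek.
have mY y : measurable (E `&` [set w | Y w = y]).
  have [->|[w0 _ ->]] := past_cylinder y; first exact: measurable0.
  exact: cylinder_measurable.
rewrite (@total_probability mu _ Y) => [|y]; last first.
  by rewrite setIAC; apply: measurableI.
rewrite (@total_probability mu _ Y E)// ge0_sume_distrl; last first.
  by move=> y _; exact: measure_ge0.
apply: eq_bigr => y _; rewrite setIAC.
have [->|[w0 Ew0 ->]] := past_cylinder y; first by rewrite set0I measure0 mul0e.
pose x m := if (m <= n)%N then X m w0 else l.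
have -> : cylinder X n (fun m => X m w0) = cylinder X n x.
  by apply/seteqP; split => w H m mn; have := H m mn; rewrite /x mn.
have -> : cylinder X n x `&` [set w | X n.+1 w = l] = cylinder X n.+1 x.
  apply/seteqP; split => w.
    move=> [H /= Hl] m; rewrite leq_eqVlt => /orP[/eqP->|]; last exact: H.
    by rewrite /x ltnn.
  move=> H; split => [m mn|/=]; first by apply: H; rewrite ltnW.
  by have := H n.+1 (leqnn _); rewrite /x ltnn.
case: hmu => _ ->; congr (_ * (P _ _)%:E)%E; first by rewrite /x leqnn Ek.
by rewrite /x ltnn.
Qed.

End Past.

Variable j : S.
(** The event that the hitting time of [j] exceeds [n]. *)
Definition survival n : set Omega := [set w | forall k, (k <= n)%N -> X k w <> j].

Let survival_at n k := survival n `&` [set w | X n w = k].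

Let surv_past n k : forall w w', (forall m, (m <= n)%N -> X m w = X m w') ->
  survival_at n k w -> survival_at n k w'.
Proof.
move=> w w' H [sw /= Xk]; split; last by rewrite /= -H.
by move=> m mn; rewrite -H//; exact: sw.
Qed.

Lemma survival_measurable n : measurable (survival n).
Proof.
apply: (@past_measurable n) => w w' H sw m mn; rewrite -H//; exact: sw.
Qed.

Let survival_at_measurable n k : measurable (survival_at n k).
Proof. exact: past_measurable (@surv_past n k). Qed.

Let m n k := fine (mu (survival_at n k)).
Let mE n k : mu (survival_at n k) = (m n k)%:E.
Proof. by rewrite fineK// fin_num_measure. Qed.

Let m_next n l : m n.+1 l = (l != j)%:R * \sum_k m n k * P k l.
Proof.
apply: EFin_inj; rewrite -mE; have [->|lj] := eqVneq l j.
  rewrite mul0r (_ : survival_at _ _ = set0) ?measure0//.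
  by apply/seteqP; split => // w [sw /= Xj]; case: (sw n.+1).
rewrite mul1r.
have -> : survival_at n.+1 l = survival n `&` [set w | X n.+1 w = l].
  apply/seteqP; split => w [sw /= Xl]; split => // k kn.
    by apply: sw; rewrite ltnW.
  move: kn; rewrite leq_eqVlt => /orP[/eqP->|]; last exact: sw.
  by rewrite Xl; apply/eqP.
rewrite (@total_probability mu _ (X n)) => [|k]; last first.
  rewrite setIAC; apply: measurableI (mX _ _); exact: survival_at_measurable.
rewrite -sumEFin; apply: eq_bigr => k _.
rewrite setIAC (@markov_past n (survival_at n k) (@surv_past n k) k)//.
  by rewrite mE EFinM.
by move=> w [].
Qed.

(** The transition operator killed at [j]. It is iterated on functions vanishing at [j], a property
    that the factor at the starting point preserves. *)
Definition killed (f : S -> R) k := (k != j)%:R * \sum_l P k l * f l.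

(* The Markov property extends paths at their end, the first-step equations at
   their beginning; this transposes one into the other. *)
Let m_duality i (f : S -> R) n : (forall k, m 0 k = (k == i)%:R * (i != j)%:R) ->
  \sum_k m n k * f k = iter n killed (fun k => (k != j)%:R * f k) i.
Proof.
move=> m0; elim: n f => [|n IH] f.
  rewrite (bigD1 i)//= m0 eqxx mul1r big1 ?addr0// => k ki.
  by rewrite m0 (negPf ki) !mul0r.
have -> : \sum_l m n.+1 l * f l =
    \sum_k m n k * (\sum_l P k l * ((l != j)%:R * f l)).
  under eq_bigr do rewrite m_next -mulrA mulrCA mulr_suml.
  rewrite exchange_big; apply: eq_bigr => k _ /=; rewrite mulr_sumr.
  by apply: eq_bigr => l _; rewrite -mulrA.
by rewrite IH iterSr.
Qed.

Lemma survival_prob i n : mu [set w | X 0%N w = i] = 1%E ->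
  mu (survival n) = (iter n killed (fun k => (k != j)%:R) i)%:E.
Proof.
move=> mui.
have null (B : set Omega) : measurable B -> B `<=` ~` [set w | X 0%N w = i] -> mu B = 0%E.
  move=> mB BC; apply/le_anti; rewrite measure_ge0 andbT.
  have <- : mu (~` [set w | X 0%N w = i]) = 0%E.
    by rewrite probability_setC// mui subee.
  by rewrite le_measure// inE//; apply: measurableC.
have m0 k : m 0 k = (k == i)%:R * (i != j)%:R.
  apply: EFin_inj; rewrite -mE; have [->|ki] := eqVneq k i; last first.
    by rewrite mul0r null// => w [_ /= Xk]; rewrite Xk; exact/eqP.
  rewrite mul1r; have [ij|ij] := eqVneq i j.
    by rewrite null// => w [sw _] /= Xi; apply: (sw 0%N) => //; rewrite Xi.
  rewrite -mui; congr (mu _); apply/seteqP; split => w /=; first by case.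
  by move=> Xi; split => // k0; rewrite leqn0 => /eqP ->; rewrite Xi; apply/eqP.
have := m_duality (fun=> 1) n m0.
under eq_bigr do rewrite mulr1.
rewrite (_ : (fun k => _ * 1) = fun k => (k != j)%:R); last first.
  by apply/funext => k; rewrite mulr1.
move=> <-; rewrite (@total_probability mu _ (X n)); last exact: survival_at_measurable.
by rewrite -sumEFin; apply: eq_bigr => k _; rewrite -mE.
Qed.

End Chain.

(** A finite hitting time [N] counts the [n < N], which are exactly the times survived; if [j] is
    never hit, all terms are [1] and the series diverges. *)
Lemma hitting_time_series j w :
  hitting_time R X j w = (\sum_(n <oo) (\1_(survival j n) w)%:E)%E.
Proof.
have t0 n : (0 <= (\1_(survival j n) w)%:E :> \bar R)%E by rewrite lee_fin.
have [[n0 Xn0]|nohit] := pselect (exists n, X n w = j); last first.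
  have -> : hitting_time R X j w = +oo%E.
    rewrite /hitting_time (_ : [set n | X n w = j] = set0).
      by rewrite image_set0 ereal_inf0.
    by apply/seteqP; split => // n /= Xn; apply: nohit; exists n.
  apply/esym/eqyP => A A0.
  apply: (le_trans _ (nneseries_lim_ge (Num.bound A) (fun n _ _ => t0 n))).
  rewrite (eq_bigr (fun=> 1%:E)); last first.
    move=> n _; rewrite indicE mem_set// => k _ Xk; apply: nohit; by exists k.
  rewrite sumEFin big_const_nat subn0 iter_addr_0 lee_fin.
  by rewrite ltW// archi_boundP// ltW.
have exX : exists n, X n w == j by exists n0; apply/eqP.
pose N := ex_minn exX.
have XN : X N w = j by rewrite /N; case: ex_minnP => k /eqP.
have Nmin n : X n w = j -> (N <= n)%N.
  by rewrite /N; case: ex_minnP => k _ H /eqP; exact: H.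
have sE n : \1_(survival j n) w = (n < N)%N%:R :> R.
  rewrite indicE; congr ((nat_of_bool _)%:R); apply/idP/idP.
    rewrite inE => sw; rewrite ltnNge; apply/negP => Nn; exact: (sw N).
  move=> nN; apply/mem_set => k kn /Nmin Nk.
  by have := leq_ltn_trans (leq_trans Nk kn) nN; rewrite ltnn.
rewrite (nneseries_split 0 N) ?add0n// [X in (_ + X)%E]eseries0 ?adde0; last first.
  by move=> k Nk _; rewrite sE ltnNge Nk.
have -> : (\sum_(0 <= k < N) (\1_(survival j k) w)%:E = (N%:R)%:E :> \bar R)%E.
  rewrite big_nat (eq_bigr (fun=> 1%:E)) -?big_nat; last first.
    by move=> k /andP[_ kN]; rewrite sE kN.
  by rewrite sumEFin big_const_nat subn0 iter_addr_0.
apply/le_anti/andP; split.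
  by apply: ereal_inf_lbound; exists N.
by apply: le_ereal_inf_tmp => _ [n /= /Nmin Nn <-]; rewrite lee_fin ler_nat.
Qed.

Section Expectation.
Variable Pr : S -> probability Omega R.
Hypotheses (hP : stochastic P) (hirr : irreducible_chain P).
Hypothesis hX : markov_family P Pr X.

Let q j n i := iter n (killed j) (fun k => (k != j)%:R) i.

Let q_ge0 j n i : 0 <= q j n i.
Proof.
elim: n i => [|n IH] i; first by rewrite /q /= ler0n.
have [P0 _] := hP; rewrite /q iterS /killed mulr_ge0 ?ler0n// sumr_ge0// => l _.
by rewrite mulr_ge0//; exact: IH.
Qed.

Lemma expected_hitting_time_series i j :
  expected_hitting_time Pr X i j = (\sum_(n <oo) (q j n i)%:E)%E.
Proof.
have [hm h1] := hX i.
have ms n : measurable (survival j n) by exact: survival_measurable hm j n.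
rewrite /expected_hitting_time; under eq_integral do rewrite hitting_time_series.
rewrite integral_nneseries//; last first.
  by move=> n; apply/measurable_realfun.measurable_EFinP; exact: measurable_realfun.measurable_indic.
apply: eq_eseriesr => n _; rewrite integral_indic// setIT.
exact: (survival_prob hm j n h1).
Qed.

(** The killed Poisson solution with source [1] dominates the partial sums of the survival series.
    Splitting off the term at [n = 0] and exchanging sums gives the first-step equation. *)
Lemma expected_hitting_time_first_step j : exists t : S -> R,
  [/\ forall i, expected_hitting_time Pr X i j = (t i)%:E, t j = 0 &
      forall i, i != j -> t i = 1 + \sum_k P i k * t k].
Proof.
have [P0 _] := hP.
have [u [u0 hu]] := @poisson_supersolution _ _ _ hP hirr j (fun=> 1) (fun=> ler01).
pose T i : \bar R := (\sum_(n <oo) (q j n i)%:E)%E.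
have T0 i : (0 <= T i)%E by apply: nneseries_ge0 => n _ _; rewrite lee_fin.
have qS n i : q j n.+1 i = (i != j)%:R * \sum_k P i k * q j n k by [].
have qj n : q j n j = 0 by case: n => [|n]; rewrite ?qS /q /= ?eqxx ?mul0r.
(* The indicator discards [u j], a mean return time, since [j] is hit at time [0] from itself. *)
have part n i : \sum_(0 <= m < n) q j m i <= (i != j)%:R * u i.
  elim: n i => [|n IH] i; first by rewrite big_geq// mulr_ge0.
  rewrite big_nat_recl// hu mulrDr mulr1; apply: lerD; first by [].
  under eq_bigr do rewrite qS.
  rewrite -mulr_sumr; apply: ler_wpM2l => //.
  rewrite exchange_big /= [leRHS]big_mkcond /=; apply: ler_sum => k _.
  rewrite -mulr_sumr; case: ifP => kj.
    by apply: ler_wpM2l => //; have := IH k; rewrite kj mul1r.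
  have -> : k = j by apply/eqP; move/negbFE: kj.
  by rewrite big1 ?mulr0.
have Tle i : (T i <= ((i != j)%:R * u i)%:E)%E.
  apply: (lime_le (is_cvg_nneseries _)); first by move=> n _ _; rewrite lee_fin.
  by apply: nearW => n; rewrite sumEFin lee_fin.
have Tf i : (fine (T i))%:E = T i.
  by rewrite fineK// ge0_fin_numE// (le_lt_trans (Tle i))// ltry.
exists (fun i => fine (T i)); split.
- by move=> i; rewrite Tf expected_hitting_time_series.
- by rewrite /T eseries0// => n _ _; rewrite qj.
- move=> i ij; apply: EFin_inj; rewrite Tf.
  rewrite {1}/T nneseries_recl//; last by move=> n _; rewrite lee_fin.
  rewrite {1}/q /= ij EFinD; congr (_ + _)%E.
  rewrite -nneseries_addn; last by move=> n; rewrite lee_fin.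
  under eq_eseriesr do rewrite addn1 qS ij mul1r -sumEFin.
  rewrite nneseries_sum; last by move=> k n _; rewrite lee_fin mulr_ge0.
  rewrite -sumEFin; apply: eq_bigr => k _; rewrite EFinM Tf /T.
  under eq_eseriesr do rewrite EFinM.
  by rewrite nneseriesZl// => n _; rewrite lee_fin.
Qed.

End Expectation.
End HittingTime.

(** * Reduction of the extended-real statements to the real-valued systems *)

Lemma entropy_rateE (R : realType) (S : finType) (P : S -> S -> R) (pi : S -> R) :
  entropy_rate P pi = \sum_i pi i * row_entropy P i.
Proof.
rewrite /entropy_rate -sumrN; apply: eq_bigr => i _.
rewrite /row_entropy mulrN mulr_sumr; congr (- _).
by apply: eq_bigr => j _; rewrite mulrA.
Qed.

Theorem theorem1p2 (R : realType) (S : finType)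
    (P : S -> S -> R) (pi : S -> R)
    (d : measure_display) (Omega : measurableType d)
    (Pr : S -> probability Omega R) (X : nat -> Omega -> S)
    (hP : stochastic P) (hirr : irreducible_chain P) (hpi : stationary P pi)
    (hX : markov_family P Pr X) :
  [/\ (forall i j : S, i <> j ->
         commute_entropy P i j =
         (commute_time Pr X i j * (entropy_rate P pi)%:E)%E),
      (constant_row_entropy P ->
         average_entropy P pi =
           ((average_hitting_time Pr X pi + 1) * (entropy_rate P pi)%:E)%E /\
         (reversible P pi -> (2 <= #|S|)%N ->
            (((relaxation_time P + 1) * entropy_rate P pi)%:E
               <= average_entropy P pi)%E /\
            (average_entropy P pi
               <= (((#|S|%:R - 1) * relaxation_time P + 1)
                     * ln (#|S|%:R))%:E)%E)),
      (constant_row_entropy P ->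
         forall i i' : S,
           (\sum_j (pi j)%:E * traj_entropy P i j)%E =
           (\sum_j (pi j)%:E * traj_entropy P i' j)%E) &
      (constant_row_entropy P -> reversible P pi ->
         forall i j k : S, i <> j -> j <> k ->
           (traj_entropy P i j + traj_entropy P j k + traj_entropy P k i)%E =
           (traj_entropy P i k + traj_entropy P k j + traj_entropy P j i)%E)].
Proof.
have [_ p1 _] := hpi.
have /choice[t0 ht0] := expected_hitting_time_first_step hP hirr hX.
pose t i j := t0 j i.
have tE i j : expected_hitting_time Pr X i j = (t i j)%:E by case: (ht0 j).
have tj j : t j j = 0 by case: (ht0 j).
have ht i j : i != j -> t i j = 1 + \sum_k P i k * t k j.
  by case: (ht0 j) => _ _; apply.
have /choice[H0 hH0] := traj_entropy_first_step hP hirr.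
pose H i j := H0 j i.
have HE i j : traj_entropy P i j = (H i j)%:E by case: (hH0 j i).
have hH i j : H i j = row_entropy P i + \sum_(k | k != j) P i k * H k j.
  by case: (hH0 j i).
pose tav := \sum_i \sum_j pi i * pi j * t i j.
have tavE : average_hitting_time Pr X pi = tav%:E.
  rewrite /average_hitting_time /tav -sumEFin; apply: eq_bigr => i _.
  by rewrite -sumEFin; apply: eq_bigr => j _; rewrite tE.
have constH : constant_row_entropy P -> forall i j,
    H i j = entropy_rate P pi * (t i j + (i == j)%:R / pi j).
  move=> hc i j; apply: (constant_cost hP hirr hpi tj ht hH) => k.
  rewrite entropy_rateE (eq_bigr (fun l => pi l * row_entropy P k)).
    by rewrite -mulr_suml p1 mul1r.
  by move=> l _; rewrite (hc l k).
have sumH i : constant_row_entropy P ->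
    \sum_j pi j * H i j = entropy_rate P pi * (\sum_j pi j * t i j + 1).
  move=> hc; rewrite mulrDr mulr1 mulr_sumr.
  under eq_bigr do rewrite constH//.
  (* Once [pi j] cancels, the return term survives only at [j = i] and is the source of the
     [+ 1]. *)
  have E j : pi j * (entropy_rate P pi * (t i j + (i == j)%:R / pi j)) =
      entropy_rate P pi * (pi j * t i j) + entropy_rate P pi * (i == j)%:R.
    rewrite mulrCA !mulrDr; congr (_ + _ * _); rewrite mulrCA divff ?mulr1//.
    by rewrite gt_eqF// (stationary_gt0 hP hirr hpi).
  under eq_bigr do rewrite E.
  rewrite big_split/= -!mulr_sumr; congr (_ + _).
  rewrite (bigD1 i)//= eqxx big1 ?addr0 ?mulr1// => j.
  by rewrite eq_sym => /negPf ->.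
have sumHE i : (\sum_j (pi j)%:E * traj_entropy P i j = (\sum_j pi j * H i j)%:E)%E.
  by rewrite -sumEFin; apply: eq_bigr => j _; rewrite HE.
have avE : constant_row_entropy P ->
    average_entropy P pi = ((tav + 1) * entropy_rate P pi)%:E.
  move=> hc.
  have -> : average_entropy P pi = (\sum_i pi i * \sum_j pi j * H i j)%:E.
    rewrite /average_entropy -sumEFin; apply: eq_bigr => i _.
    rewrite mulr_sumr -sumEFin; apply: eq_bigr => j _.
    by rewrite HE -EFinM mulrA.
  congr (_%:E); under eq_bigr do rewrite sumH// mulrCA mulrDr mulr1.
  rewrite -mulr_sumr big_split/= p1 mulrC; congr ((_ + _) * _).
  apply: eq_bigr => i _; rewrite mulr_sumr; apply: eq_bigr => j _.
  by rewrite mulrA.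
split.
- move=> i j /eqP ij; rewrite /commute_entropy /commute_time !HE !tE.
  rewrite -!EFinD -EFinM entropy_rateE.
  by rewrite (commute_cost hP hirr hpi tj ht hH ij).
- move=> hc; rewrite avE// tavE -EFinD -EFinM; split => // hrev n2.
  have /andP[lo up] := hitting_relaxation hP hirr hpi hrev tj ht n2.
  have h0 : 0 <= entropy_rate P pi.
    rewrite entropy_rateE; apply: sumr_ge0 => i _.
    by rewrite mulr_ge0 ?(row_entropy_ge0 hP)//; case: hpi.
  have hn : entropy_rate P pi <= ln #|S|%:R.
    have -> : ln #|S|%:R = \sum_i pi i * ln #|S|%:R :> R by rewrite -mulr_suml p1 mul1r.
    rewrite entropy_rateE; apply: ler_sum => i _; apply: ler_wpM2l; first by case: hpi.
    exact: row_entropy_le_ln_card.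
  have tav0 : 0 <= tav + 1.
    rewrite addr_ge0// sumr_ge0// => i _; apply: sumr_ge0 => j _.
    by rewrite mulr_ge0 ?(hitting_ge0 hP hirr tj ht)// mulr_ge0//; case: hpi.
  rewrite !lee_fin; split; first by rewrite ler_wpM2r// lerD2r.
  (* The entropy rate is bounded first, using [0 <= tav + 1]; then [tav], using that the logarithm
     is nonnegative. *)
  apply: (@le_trans _ _ ((tav + 1) * ln #|S|%:R)); first by rewrite ler_wpM2l.
  by rewrite ler_wpM2r ?lerD2r// (le_trans h0).
- move=> hc i i'; rewrite !sumHE !sumH//.
  by rewrite (random_target hP hirr hpi tj ht i i').
- move=> hc hrev i j k /eqP ij /eqP jk; rewrite !HE -!EFinD; congr (_%:E).
  have := cyclic_tour hP hirr hpi tj ht hrev i j k.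
  rewrite !constH// (negPf ij) (negPf jk).
  rewrite (eq_sym k j) (eq_sym j i) (negPf ij) (negPf jk) !mul0r !addr0.
  (* If [i = k], both sides consist of the same return entropy and the same two entropies between
     [j] and [k]; otherwise no return term occurs. *)
  rewrite (eq_sym k i); have [->|ik] := eqVneq i k; first lra.
  by rewrite !mul0r !addr0 -!mulrDr => ->.
Qed.
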